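(* Let $(A,\Pi)$ be an oriented Lie algebroid over $M$ with a Nambu structure of order $n$, let $\mu\in\Gamma(\wedge^{\mathrm{top}}A^* )$ be a nowhere vanishing section, and let $M^\mu\in\Gamma(\wedge^{n-1}A)$ be the modular tensor field associated with $\mu$. Then the map $M^\mu:\Gamma(\wedge^{n-1}A^* )\to C^\infty(M)$, $\alpha\mapsto\iota_\alpha M^\mu$, defines a $1$-cocycle in the Leibniz algebra cohomology of $\mathcal A=(\Gamma(\wedge^{n-1}A^* ),[\cdot,\cdot])$ with coefficients in $C^\infty(M)$.
   Context: $\rho$ is the anchor of $A$, $d_A$ the Lie algebroid differential. For $X\in\Gamma A$: $\mathcal L_X=\iota_Xd_A+d_A\iota_X$ on forms; $\mathcal L_XP=[X,P]$ (Schouten bracket) on multisections. Contractions: multisections are evaluated by $P(\alpha_1\wedge\cdots\wedge\alpha_k)=P(\alpha_1,\dots,\alpha_k)$, with $(X_1\wedge\cdots\wedge X_k)(\alpha_1,\dots,\alpha_k)=\det(\alpha_i(X_j))$; for $\alpha\in\Gamma A^*$, $(\iota_\alpha P)(\beta)=P(\alpha\wedge\beta)$ and $\iota_{\alpha_1\wedge\cdots\wedge\alpha_k}=\iota_{\alpha_k}\circ\cdots\circ\iota_{\alpha_1}$, extended linearly. $\Pi^\sharp\alpha=\iota_\alpha\Pi$. Nambu structure of order $n$ ($3\le n\le\operatorname{rank}A$): $\Pi\in\Gamma(\wedge^nA)$ with $\mathcal L_{\Pi^\sharp\alpha}\Pi=(-1)^n(\iota_{d_A\alpha}\Pi)\Pi$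 for all $\alpha\in\Gamma(\wedge^{n-1}A^* )$. The (left) Leibniz algebra $\mathcal A$: $\Gamma(\wedge^{n-1}A^* )$ with $[\alpha,\beta]=\mathcal L_{\Pi^\sharp\alpha}\beta+(-1)^n(\iota_{d_A\alpha}\Pi)\beta$, acting on $C^\infty(M)$ by $(\alpha,f)\mapsto\rho(\Pi^\sharp\alpha)(f)$. A $1$-cochain is an $\mathbb R$-linear map $c:\Gamma(\wedge^{n-1}A^* )\to C^\infty(M)$; it is a $1$-cocycle iff $\rho(\Pi^\sharp\alpha)(c(\beta))-\rho(\Pi^\sharp\beta)(c(\alpha))=c([\alpha,\beta])$ for all $\alpha,\beta$. Modular tensor field: $M^\mu\in\Gamma(\wedge^{n-1}A)$ is defined by $(\iota_\alpha M^\mu)\mu=\mathcal L_{\Pi^\sharp\alpha}\mu+(-1)^n(\iota_{d_A\alpha}\Pi)\mu$ for all $\alpha\in\Gamma(\wedge^{n-1}A^* )$. *)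

(* Defs.v *)
From HB Require Import structures.
From mathcomp Require Import all_boot all_order all_fingroup all_algebra.
From mathcomp Require Import all_classical all_reals all_analysis.

Set Implicit Arguments.
Unset Strict Implicit.
Unset Printing Implicit Defensive.

Import Order.TTheory GRing.Theory Num.Theory numFieldNormedType.Exports.

Local Open Scope classical_set_scope.
Local Open Scope ring_scope.

(* [U] is meant to be open: directional derivatives of all orders up to [k]
   exist and are continuous on [U]. *)
Fixpoint Ck (R : realType) (m k : nat) (U : set 'rV[R]_m) (f : 'rV[R]_m -> R)
    : Prop :=
  (forall x, U x -> {for x, continuous f}) /\
  match k with
  | 0%N => True
  | k'.+1 => (forall v x, U x -> derivable f x v) /\
             (forall v, Ck k' U ('D_v f))
  end.

Definition Cinfty (R : realType) (m : nat) (U : set 'rV[R]_m)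
    (f : 'rV[R]_m -> R) : Prop := forall k, Ck k U f.

(* Charts are given by total functions [chart i] and [chart_inv i], which are
   only meaningful on [chart_dom i] and on its image respectively. *)
Record manifold (R : realType) (m : nat) := Manifold {
  point_of :> topologicalType;
  manifold_hausdorff : hausdorff_space point_of;
  manifold_countable : @second_countable point_of;
  chart_index : Type;
  chart_dom : chart_index -> set point_of;
  chart : chart_index -> point_of -> 'rV[R]_m;
  chart_inv : chart_index -> 'rV[R]_m -> point_of;
  chart_dom_open : forall i, open (chart_dom i);
  chart_cover : forall x, exists i, chart_dom i x;
  chart_image_open : forall i, open (chart i @` chart_dom i);
  chartK : forall i x, chart_dom i x -> chart_inv i (chart i x) = x;
  chart_continuous : forall i x, chart_dom i x ->
    {for x, continuous (chart i)};
  chart_inv_continuous : forall i y, (chart i @` chart_dom i) y ->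
    {for y, continuous (chart_inv i)};
  chart_transition : forall i j (a : 'I_m),
    Cinfty (chart i @` (chart_dom i `&` chart_dom j))
      (fun y => chart j (chart_inv i y) ord0 a) }.

Section Functions.
Context {R : realType} {m : nat} {M : manifold R m}.

Definition smooth_on (V : set M) (f : M -> R) : Prop :=
  forall i : chart_index M,
    Cinfty (chart i @` (chart_dom i `&` V)) (f \o chart_inv i).

Definition smooth (f : M -> R) : Prop := smooth_on setT f.

End Functions.

Section Fibre.
Context {R : realType}.

Definition covector (V : vectType R) : vectType R := 'Hom(V, R^o).

Definition multilinear (k : nat) (V : lmodType R) (f : ('I_k -> V) -> R) :=
  forall (w : 'I_k -> V) (i : 'I_k) (a : R) (u v : V),
    f (dfwith w i (a *: u + v)) = a * f (dfwith w i u) + f (dfwith w i v).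

Definition alternating_map (k : nat) (V : lmodType R) (f : ('I_k -> V) -> R) :=
  forall (w : 'I_k -> V) (i j : 'I_k), i != j -> w i = w j -> f w = 0.

(* Elements of the k-th exterior power of V^* are k-linear alternating maps on
   V; elements of the k-th exterior power of V are k-linear alternating maps
   on V^*, with (X_1 /\ ... /\ X_k)(b_1, ..., b_k) = det (b_i X_j). *)
Definition altmap (k : nat) (V : lmodType R) (f : ('I_k -> V) -> R) :=
  multilinear f /\ alternating_map f.

Definition wedge_covectors (k : nat) (V : vectType R)
    (b : 'I_k -> covector V) : ('I_k -> V) -> R :=
  fun v => \det (\matrix_(i < k, j < k) b i (v j)).

Definition basis_vector (V : vectType R) (i : 'I_(\dim {:V})) : V :=
  (vbasis {:V})`_i.

Definition dual_vector (V : vectType R) (i : 'I_(\dim {:V})) : covector V :=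
  linfun (coord (vbasis {:V}) i : V -> R^o).

Definition extend_by (k l : nat) (T : Type) (s : 'I_k -> T) (t : 'I_l -> T)
    : 'I_(l + k) -> T :=
  fun c => match fintype.split (cast_ord (addnC l k) c) with
           | inl a => s a
           | inr b => t b
           end.

(* i_w P, with (i_w P)(b) = P(w /\ b). It is obtained from
     i_(w_1 /\ ... /\ w_k) P (b_1, ..., b_l) = P(w_1, ..., w_k, b_1, ..., b_l)
   by linearity, writing w = 1/k! \sum_I w(e_I1, ..., e_Ik) e^I1 /\ ... /\ e^Ik
   in a basis e of V (see [contract_form_wedge]). The degree is written l + k so
   that it is convertible to k for l = 0 and to k.+1 for l = 1. *)
Definition contract_form (k l : nat) (V : vectType R) (w : ('I_k -> V) -> R)
    (P : ('I_(l + k) -> covector V) -> R) : ('I_l -> covector V) -> R :=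
  fun b => (k`!%:R)^-1 *
    \sum_(I : {ffun 'I_k -> 'I_(\dim {:V})})
      w (fun a => basis_vector (I a)) *
      P (extend_by (fun a => dual_vector (I a)) b).

Definition pairing (k : nat) (V : vectType R) (w : ('I_k -> V) -> R)
    (P : ('I_k -> covector V) -> R) : R :=
  @contract_form k 0 V w P (fun _ => 0).

(* The vector corresponding to an element of the bidual of V
   (see [bidual_vectorE]). *)
Definition bidual_vector (V : vectType R) (Q : ('I_1 -> covector V) -> R) : V :=
  \sum_(i < \dim {:V}) Q (fun _ => dual_vector i) *: basis_vector i.

Definition ocons (k : nat) (T : Type) (t : T) (s : 'I_k -> T) : 'I_k.+1 -> T :=
  fun i => if unlift ord0 i is Some a then s a else t.

Lemma ocons_dfwith (k : nat) (T : Type) (t : T) (s : 'I_k -> T) i u :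
  ocons t (dfwith s i u) = dfwith (ocons t s) (lift ord0 i) u.
Proof.
apply/funext => a; rewrite /ocons; case: (unliftP ord0 a) => [b ->|->].
  have [<-|ib] := eqVneq i b; first by rewrite !dfwithin.
  by rewrite !dfwithout ?liftK // (inj_eq lift_inj).
by rewrite dfwithout ?unlift_none // eq_sym neq_lift.
Qed.

Lemma ocons_dfwith0 (k : nat) (T : Type) (t u : T) (s : 'I_k -> T) :
  dfwith (ocons t s) ord0 u = ocons u s.
Proof.
apply/funext => a; rewrite /ocons; case: (unliftP ord0 a) => [b ->|->].
  by rewrite dfwithout ?liftK // neq_lift.
by rewrite dfwithin.
Qed.

Lemma multilinear_sum (k d : nat) (V : lmodType R) (f : ('I_k -> V) -> R)
    (u : 'I_d -> V) (c : 'I_k -> 'I_d -> R) :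
  multilinear f ->
  f (fun a => \sum_(j < d) c a j *: u j) =
  \sum_(I : {ffun 'I_k -> 'I_d}) (\prod_a c a (I a)) * f (u \o I).
Proof.
elim: k f c => [|k IH] f c fml.
  have I0 : {ffun 'I_0 -> 'I_d} by exact: [ffun i : 'I_0 => match i with Ordinal _ h => match notF h with end end].
  rewrite (big_pred1 I0) => [|I]; last by apply/esym/eqP/ffunP => -[].
  by rewrite big_ord0 mul1r; congr f; apply/funext => -[].
set w := fun a => _.
have -> : w = ocons (\sum_(j < d) c ord0 j *: u j) (w \o lift ord0).
  by apply/funext => a; rewrite /ocons; case: (unliftP ord0 a) => [b ->|->].
have sum0 t (g : 'I_d -> R) :
    f (ocons (\sum_j g j *: u j) t) = \sum_j g j * f (ocons (u j) t).
  have f0 : f (ocons 0 t) = 0.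
    have := fml (ocons 0 t) ord0 (-1) 0 0.
    by rewrite !ocons_dfwith0 scaler0 addr0 mulN1r addNr.
  elim/big_rec2: _ => // j y1 y2 _ <-.
  by have := fml (ocons 0 t) ord0 (g j) (u j) y2; rewrite !ocons_dfwith0.
rewrite sum0.
have IHj j : f (ocons (u j) (w \o lift ord0)) =
    \sum_(I : {ffun 'I_k -> 'I_d}) (\prod_a c (lift ord0 a) (I a)) *
      f (ocons (u j) (u \o I)).
  apply: (IH (fun s => f (ocons (u j) s)) (fun a => c (lift ord0 a))).
  by move=> s i a v v'; rewrite !ocons_dfwith fml.
under eq_bigr do rewrite IHj mulr_sumr.
rewrite pair_big /=.
rewrite (reindex (fun p : 'I_d * {ffun 'I_k -> 'I_d} =>
   [ffun a : 'I_k.+1 => ocons p.1 p.2 a])) /=; last first.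
  exists (fun I => (I ord0, [ffun a => I (lift ord0 a)])) => [[j I] _|I _] /=.
    congr pair; first by rewrite ffunE /ocons unlift_none.
    by apply/ffunP => a; rewrite !ffunE /ocons liftK.
  apply/ffunP => a; rewrite !ffunE /ocons.
  by case: (unliftP ord0 a) => [b ->|->]; rewrite ?ffunE.
apply: eq_bigr => -[j I] _ /=.
rewrite big_ord_recl mulrA !ffunE /ocons unlift_none; congr (_ * _ * f _).
  by apply: eq_bigr => a _; rewrite !ffunE liftK.
by apply/funext => a /=; rewrite ffunE; case: unlift.
Qed.

Lemma alternating_tperm (k : nat) (V : lmodType R) (f : ('I_k -> V) -> R) w i j :
  altmap f -> i != j -> f (w \o tperm i j) = - f w.
Proof.
move=> [fml fal] ij.
pose g x y := dfwith (dfwith w i x) j y.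
have gD1 x x' y : f (g (x + x') y) = f (g x y) + f (g x' y).
  have E z : g z y = dfwith (dfwith w j y) i z.
    apply/funext => a; rewrite /g; have [<-|ja] := eqVneq j a.
      by rewrite dfwithin dfwithout // dfwithin.
    rewrite dfwithout //; have [<-|ia] := eqVneq i a; first by rewrite !dfwithin.
    by rewrite !dfwithout.
  by have := fml (dfwith w j y) i 1 x x'; rewrite scale1r mul1r -!E.
have gD2 x y y' : f (g x (y + y')) = f (g x y) + f (g x y').
  by have := fml (dfwith w i x) j 1 y y'; rewrite scale1r mul1r.
have gg x : f (g x x) = 0.
  apply: (fal _ i j ij); rewrite /g dfwithin dfwithout 1?eq_sym //.
  by rewrite dfwithin.
have /eqP := gg (w i + w j).
rewrite gD1 !gD2 !gg add0r addr0 addrC addr_eq0 => /eqP.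
have -> : g (w i) (w j) = w.
  apply/funext => a; rewrite /g; have [<-|ja] := eqVneq j a; first by rewrite dfwithin.
  rewrite dfwithout //; have [<-|ia] := eqVneq i a; first by rewrite dfwithin.
  by rewrite dfwithout.
move=> <-; congr f; apply/funext => a; rewrite /g /=.
have [<-|ja] := eqVneq j a; first by rewrite dfwithin tpermR.
rewrite dfwithout //; have [<-|ia] := eqVneq i a; first by rewrite dfwithin tpermL.
by rewrite dfwithout // tpermD.
Qed.

Lemma alternating_perm (k : nat) (V : lmodType R) (f : ('I_k -> V) -> R) w
    (s : {perm 'I_k}) :
  altmap f -> f (w \o s) = (-1) ^+ s * f w.
Proof.
move=> falt; have [ts -> tsd] := prod_tpermP s.
elim: ts tsd w => [|[i j] ts IH] /= => [_|/andP[ij tsd]] w.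
  rewrite big_nil odd_perm1 mul1r; congr f; apply/funext => a /=.
  by rewrite perm1.
rewrite big_cons odd_mul_tperm /= ij signr_addb -mulrA mulN1r -(IH tsd) //.
rewrite -(@alternating_tperm _ _ _ _ i j) //.
by congr f; apply/funext => a /=; rewrite permM.
Qed.

Lemma extend_by_dfwith (k l : nat) (T : Type) (s : 'I_k -> T) (t : 'I_l -> T) a u :
  extend_by (dfwith s a u) t =
  dfwith (extend_by s t) (cast_ord (addnC k l) (lshift l a)) u.
Proof.
apply/funext => c; rewrite /extend_by.
set c' := cast_ord _ c.
have -> : c = cast_ord (addnC k l) c' by apply/val_inj.
case: (splitP c') => b cb.
  have {cb} -> : c' = lshift l b by apply/val_inj.
  have [<-|ab] := eqVneq a b; first by rewrite !dfwithin.
  rewrite !dfwithout ?(inj_eq (@cast_ord_inj _ _ _)) ?(inj_eq (@lshift_inj _ _)) //.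
  have -> : cast_ord (addnC l k) (cast_ord (addnC k l) (lshift l b)) = lshift l b by apply/val_inj.
  by case: splitP => b' /= bb'; [congr s; exact/val_inj|have := ltn_ord b; rewrite bb' ltnNge leq_addr].
have {cb} -> : c' = rshift k b by apply/val_inj.
rewrite dfwithout ?(inj_eq (@cast_ord_inj _ _ _)) ?eq_lrshift //.
have -> : cast_ord (addnC l k) (cast_ord (addnC k l) (rshift k b)) = rshift k b by apply/val_inj.
case: splitP => b' /= bb'; first by have := ltn_ord b'; rewrite -bb' ltnNge leq_addr.
by congr t; apply/val_inj/eqP; rewrite -(eqn_add2l k) bb'.
Qed.

Lemma extend_byL (k l : nat) (T : Type) (s : 'I_k -> T) (t : 'I_l -> T) a :
  extend_by s t (cast_ord (addnC k l) (lshift l a)) = s a.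
Proof.
rewrite /extend_by; case: splitP => b /= ab; first by congr s; exact/val_inj.
by have := ltn_ord a; rewrite ab ltnNge leq_addr.
Qed.

Lemma altmap_extend (k l : nat) (V : vectType R)
    (P : ('I_(l + k) -> covector V) -> R) c :
  altmap P -> altmap (fun b : 'I_k -> covector V => P (extend_by b c)).
Proof.
move=> [Pml Pal]; split=> [w i a u v|w i j ij wij].
  by rewrite !extend_by_dfwith Pml.
apply: (Pal _ (cast_ord (addnC k l) (lshift l i))
              (cast_ord (addnC k l) (lshift l j))).
  by rewrite (inj_eq (@cast_ord_inj _ _ _)) (inj_eq (@lshift_inj _ _)).
by rewrite !extend_byL.
Qed.

Lemma dual_vectorE (V : vectType R) (b : covector V) :
  b = \sum_(i < \dim {:V}) (b (basis_vector i) : R) *: dual_vector i.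
Proof.
apply/lfunP => v; rewrite sum_lfunE.
rewrite {1}(coord_vbasis (memvf v)) linear_sum; apply: eq_bigr => i _.
by rewrite linearZ /= scale_lfunE lfunE /= [LHS]mulrC.
Qed.

Lemma contract_form_wedge (k l : nat) (V : vectType R) (b : 'I_k -> covector V)
    (P : ('I_(l + k) -> covector V) -> R) (c : 'I_l -> covector V) :
  altmap P -> contract_form (wedge_covectors b) P c = P (extend_by b c).
Proof.
move=> /(@altmap_extend _ _ _ _ c) falt.
rewrite /contract_form; set f := (fun b => P (extend_by b c)) in falt *.
have -> : P (extend_by b c) = f b by [].
have fE : f b = \sum_(I : {ffun 'I_k -> 'I_(\dim {:V})})
    (\prod_a (b a (basis_vector (I a)) : R)) * f (fun a => dual_vector (I a)).
  rewrite {1}(_ : b = fun a => \sum_(i < \dim {:V})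
    (b a (basis_vector i) : R) *: dual_vector i).
    exact: multilinear_sum falt.1.
  by apply/funext => a; exact: dual_vectorE.
rewrite /wedge_covectors /determinant.
under eq_bigr do rewrite mulr_suml.
rewrite exchange_big /= (eq_bigr (fun=> f b)) => [|s _].
  by rewrite sumr_const card_Sn -[f b *+ _]mulr_natl mulKf // pnatr_eq0 -lt0n fact_gt0.
rewrite fE (reindex (fun I : {ffun 'I_k -> 'I_(\dim {:V})} =>
    [ffun a => I ((s^-1)%g a)])) /=; last first.
  exists (fun I => [ffun a => I (s a)]) => I _ /=;
    by apply/ffunP => a; rewrite !ffunE ?permK ?permKV.
apply: eq_bigr => I _; rewrite -/(f _).
have -> : (fun a => dual_vector ([ffun a0 => I ((s^-1)%g a0)] a)) =
    (fun a => dual_vector (I a)) \o (s^-1)%g.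
  by apply/funext => a /=; rewrite ffunE.
rewrite (alternating_perm _ _ falt) odd_permV.
under eq_bigr do rewrite mxE ffunE permK.
by rewrite -mulrA [X in _ * X]mulrCA signrMK.
Qed.
Lemma bidual_vectorE (V : vectType R) (Q : ('I_1 -> covector V) -> R)
    (b : 'I_1 -> covector V) :
  multilinear Q -> b ord0 (bidual_vector Q) = Q b.
Proof.
move=> Qml; have cE (c c' : 'I_1 -> covector V) : c ord0 = c' ord0 -> c = c'.
  by move=> cc'; apply/funext => i; rewrite ord1.
have -> : Q b = Q (fun a => \sum_(j < \dim {:V})
    (b a (basis_vector j) : R) *: dual_vector j).
  by congr Q; apply: cE; exact: dual_vectorE.
rewrite (multilinear_sum _ _ Qml) /bidual_vector linear_sum.
rewrite [RHS](reindex (fun i => [ffun a : 'I_1 => i])) /=; last first.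
  exists (fun I => I ord0) => [i _|I _] /=; first by rewrite ffunE.
  by apply/ffunP => a; rewrite ffunE (ord1 a).
apply: eq_bigr => i _; rewrite linearZ /= big_ord1 ffunE [LHS]mulrC.
by congr (_ * Q _); apply: cE; rewrite /= ffunE.
Qed.

End Fibre.

(* A vector bundle of rank r, given by its fibres and by local frames over an
   open cover whose transition functions are smooth. *)
Record vbundle (R : realType) (m : nat) (M : manifold R m) (r : nat) := VBundle {
  fibre :> M -> vectType R;
  frame_index : Type;
  frame_dom : frame_index -> set M;
  frame : frame_index -> forall x : M, r.-tuple (fibre x);
  frame_dom_open : forall j, open (frame_dom j);
  frame_cover : forall x, exists j, frame_dom j x;
  frame_basis : forall j x, frame_dom j x -> basis_of {:fibre x} (frame j x);
  frame_transition : forall j j' (a b : 'I_r),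
    smooth_on (frame_dom j `&` frame_dom j')
      (fun x => coord (frame j' x) a (tnth (frame j x) b)) }.

Section Sections.
Context {R : realType} {m : nat} {M : manifold R m} {r : nat} (A : vbundle M r).

Definition sect := forall x : M, A x.

Definition smooth_sect (X : sect) : Prop :=
  forall (j : frame_index A) (a : 'I_r),
    smooth_on (frame_dom j) (fun x => coord (frame j x) a (X x)).

Definition dual_sect := forall x : M, covector (A x).

Definition smooth_dual_sect (b : dual_sect) : Prop :=
  forall (j : frame_index A) (a : 'I_r),
    smooth_on (frame_dom j) (fun x => b x (tnth (frame j x) a)).

Definition dual_frame (j : frame_index A) (x : M) (a : 'I_r) : covector (A x) :=
  linfun (coord (frame j x) a : A x -> R^o).

Definition kform (k : nat) := forall x : M, ('I_k -> A x) -> R.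

Definition smooth_form (k : nat) (w : kform k) : Prop :=
  (forall x, altmap (w x)) /\
  forall (j : frame_index A) (I : 'I_k -> 'I_r),
    smooth_on (frame_dom j) (fun x => w x (fun a => tnth (frame j x) (I a))).

Definition multisect (k : nat) := forall x : M, ('I_k -> covector (A x)) -> R.

Definition smooth_multisect (k : nat) (P : multisect k) : Prop :=
  (forall x, altmap (P x)) /\
  forall (j : frame_index A) (I : 'I_k -> 'I_r),
    smooth_on (frame_dom j) (fun x => P x (fun a => dual_frame j x (I a))).

(* An orientation: a sign for each basis of each fibre, compatible with the
   sign of determinants and locally constant on local frames. *)
Record orientation := Orientation {
  negative_basis : forall x : M, r.-tuple (A x) -> bool;
  orientation_det : forall (x : M) (e e' : r.-tuple (A x)),
    basis_of {:A x} e -> basis_of {:A x} e' ->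
    negative_basis e' =
      negative_basis e (+)
        (\det (\matrix_(a < r, b < r) coord e a (tnth e' b)) < 0);
  orientation_loc : forall (j : frame_index A) (x : M), frame_dom j x ->
    \forall y \near x, negative_basis (frame j y) = negative_basis (frame j x) }.

End Sections.

(* [anchor x v] is the tangent vector \rho(v) at x, seen as a derivation at x
   of smooth functions. *)
Record lie_algebroid (R : realType) (m : nat) (M : manifold R m) (r : nat) :=
  LieAlgebroid {
  bundle :> vbundle M r;
  anchor : forall x : M, bundle x -> (M -> R) -> R;
  bracket : sect bundle -> sect bundle -> sect bundle;
  anchor_linear : forall x (a : R) (u v : bundle x) f, smooth f ->
    anchor (a *: u + v) f = a * anchor u f + anchor v f;
  anchor_linear_fun : forall x (v : bundle x) (a : R) f g,
    smooth f -> smooth g ->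
    anchor v (fun y => a * f y + g y) = a * anchor v f + anchor v g;
  anchor_leibniz : forall x (v : bundle x) f g, smooth f -> smooth g ->
    anchor v (fun y => f y * g y) = f x * anchor v g + g x * anchor v f;
  anchor_smooth : forall (X : sect bundle) f, smooth_sect X -> smooth f ->
    smooth (fun x => anchor (X x) f);
  bracket_smooth : forall X Y, smooth_sect X -> smooth_sect Y ->
    smooth_sect (bracket X Y);
  bracket_linear : forall (a : R) X Y Z,
    smooth_sect X -> smooth_sect Y -> smooth_sect Z ->
    bracket (fun x => a *: X x + Y x) Z =
      (fun x => a *: bracket X Z x + bracket Y Z x);
  bracket_anti : forall X Y, smooth_sect X -> smooth_sect Y ->
    bracket X Y = (fun x => - bracket Y X x);
  bracket_jacobi : forall X Y Z,
    smooth_sect X -> smooth_sect Y -> smooth_sect Z ->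
    bracket X (bracket Y Z) =
      (fun x => bracket (bracket X Y) Z x + bracket Y (bracket X Z) x);
  bracket_leibniz : forall X Y f,
    smooth_sect X -> smooth_sect Y -> smooth f ->
    bracket X (fun x => f x *: Y x) =
      (fun x => f x *: bracket X Y x + anchor (X x) f *: Y x);
  anchor_bracket : forall X Y f,
    smooth_sect X -> smooth_sect Y -> smooth f ->
    forall x, anchor (bracket X Y x) f =
      anchor (X x) (fun y => anchor (Y y) f) -
      anchor (Y x) (fun y => anchor (X y) f) }.

(* Definite description, with default value [d]. *)
Definition the (T : Type) (d : T) (P : T -> Prop) : T :=
  if pselect (exists t, P t) is left h then projT1 (cid h) else d.

Section Calculus.
Context {R : realType} {m : nat} {M : manifold R m} {r : nat}.
Context {A : lie_algebroid M r}.

Definition anchor_act (X : sect A) (f : M -> R) : M -> R := fun x => anchor (X x) f.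

(* The Koszul formula
     \sum_i (-1)^i \rho(X_i) (w (.. ^X_i ..))
     + \sum_(i < j) (-1)^(i + j) w ([X_i, X_j], .. ^X_i .. ^X_j ..).
   In the second sum the bracket is moved to the place of X_j = X_(lift i a),
   which replaces the sign (-1)^(i + j) by - (-1)^i. *)
Definition koszul (k : nat) (w : kform A k) (X : 'I_k.+1 -> sect A) : M -> R :=
  fun x =>
  \sum_(i < k.+1) (-1) ^+ i *
    anchor_act (X i) (fun y => w y (fun a => X (lift i a) y)) x
  - \sum_(i < k.+1) \sum_(a < k | (i < lift i a)%N) (-1) ^+ i *
      w x (dfwith (fun b => X (lift i b) x) a (bracket (X i) (X (lift i a)) x)).

(* d_A w is the unique form with these values on sections. *)
Definition dA (k : nat) (w : kform A k) : kform A k.+1 :=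
  the (fun _ _ => 0) (fun eta : kform A k.+1 =>
    smooth_form eta /\
    forall X : 'I_k.+1 -> sect A, (forall i, smooth_sect (X i)) ->
      forall x, eta x (fun i => X i x) = koszul w X x).
Arguments dA {k} w x _ : simpl never.

Definition interior_product (k : nat) (X : sect A) (w : kform A k.+1) : kform A k :=
  fun x v => w x (fun i => if unlift ord0 i is Some a then v a else X x).
Arguments interior_product {k} X w x _ /.

Definition lie_form (k : nat) (X : sect A) : kform A k -> kform A k :=
  match k return kform A k -> kform A k with
  | 0%N => fun w => interior_product X (dA w)
  | k'.+1 => fun w x v => interior_product X (dA w) x v + dA (interior_product X w) x v
  end.
Arguments lie_form {k} X w x _ : simpl never.

Definition lie_dual (X : sect A) (b : dual_sect A) : dual_sect A :=
  fun x => linfun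
    (fun v => lie_form X (fun y (u : 'I_1 -> A y) => b y (u ord0)) x (fun _ => v)
      : R^o).

(* The Schouten bracket [X, P] of a section and a multisection. That [X, -] is
   a derivation of the wedge product extending the bracket and the anchor
   means, after evaluation on b_1, ..., b_k,
     [X, P](b) = \rho(X) (P(b)) - \sum_i P(b_1, ..., L_X b_i, ..., b_k). *)
Definition schouten (k : nat) (X : sect A) (P : multisect A k) : multisect A k :=
  the (fun _ _ => 0) (fun Q : multisect A k =>
    smooth_multisect Q /\
    forall b : 'I_k -> dual_sect A, (forall i, smooth_dual_sect (b i)) ->
      forall x, Q x (fun i => b i x) =
        anchor_act X (fun y => P y (fun i => b i y)) x
        - \sum_(i < k) P x (dfwith (fun c => b c x) i (lie_dual X (b i) x))).
Arguments schouten {k} X P x _ : simpl never.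

Definition form_pairing (k : nat) (w : kform A k) (P : multisect A k) : M -> R :=
  fun x => pairing (w x) (P x).

Definition sharp (p : nat) (Pi : multisect A p.+1) (w : kform A p) : sect A :=
  fun x => bidual_vector (@contract_form R p 1 (A x) (w x) (Pi x)).

(* A Nambu structure of order n = p.+1, so that forms of degree n - 1 = p and
   multisections of degree n have convertible types after d_A and contraction. *)
Definition nambu (p : nat) (Pi : multisect A p.+1) : Prop :=
  (3 <= p.+1 <= r)%N /\ smooth_multisect Pi /\
  forall w : kform A p, smooth_form w ->
    schouten (sharp Pi w) Pi =
      (fun x b => (-1) ^+ p.+1 * form_pairing (dA w) Pi x * Pi x b).

Definition leibniz_bracket (p : nat) (Pi : multisect A p.+1) (w z : kform A p)
    : kform A p :=
  fun x v => lie_form (sharp Pi w) z x v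
             + (-1) ^+ p.+1 * form_pairing (dA w) Pi x * z x v.
Arguments leibniz_bracket {p} Pi w z x _.

Definition one_cochain (p : nat) (c : kform A p -> M -> R) : Prop :=
  (forall w, smooth_form w -> smooth (c w)) /\
  forall (a : R) (w z : kform A p), smooth_form w -> smooth_form z ->
    c (fun x v => a * w x v + z x v) = (fun x => a * c w x + c z x).

Definition one_cocycle (p : nat) (Pi : multisect A p.+1)
    (c : kform A p -> M -> R) : Prop :=
  one_cochain c /\
  forall w z : kform A p, smooth_form w -> smooth_form z ->
    (fun x => anchor_act (sharp Pi w) (c z) x - anchor_act (sharp Pi z) (c w) x)
      = c (leibniz_bracket Pi w z).

Definition nowhere_vanishing (k : nat) (mu : kform A k) : Prop :=
  forall x, exists v, mu x v != 0.

Definition modular_tensor_field (p : nat) (Pi : multisect A p.+1)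
    (mu : kform A r) (Mmu : multisect A p) : Prop :=
  smooth_multisect Mmu /\
  forall w : kform A p, smooth_form w -> forall x v,
    form_pairing w Mmu x * mu x v =
      lie_form (sharp Pi w) mu x v
      + (-1) ^+ p.+1 * form_pairing (dA w) Pi x * mu x v.

End Calculus.

(* Main.v *)
(* Write X_w for sharp Pi w and f_w for the factor in L_{X_w} Pi = f_w Pi. The
   Nambu condition gives X_[w,z] = [X_w, X_z], because X_w differentiates the
   contraction i_z Pi by the Leibniz rule. Since the commutator of L_{X_w} and
   L_{X_z} is L_[X_w, X_z], applying it to Pi gives
   (f_[w,z] - X_w f_z + X_z f_w) Pi = 0, and at the zeros of Pi all terms of the
   bracket vanish anyway, so f_[w,z] = X_w f_z - X_z f_w. The same commutator
   applied to mu, on which L_{X_w} acts by c(w) - f_w with c(w) = i_w M^mu, gives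
   this identity for c - f, hence for c.

   The operators d_A, L_X and the Schouten bracket exist because the formulas
   defining them on global sections are tensorial. Tensoriality is localized by
   smooth bump functions, and that of the Koszul formula is proved by induction
   on the degree through d_A w (X_0, -) = L_{X_0} w - d_A (i_{X_0} w). *)

From HB Require Import structures.
Require Import Defs.
From mathcomp Require Import all_boot all_order all_fingroup all_algebra.
From mathcomp Require Import all_classical all_reals all_analysis.
From mathcomp Require Import ring lra.

Set Implicit Arguments.
Unset Strict Implicit.
Unset Printing Implicit Defensive.

Import Order.TTheory GRing.Theory Num.Theory numFieldNormedType.Exports.

Local Open Scope classical_set_scope.
Local Open Scope ring_scope.

#[local] Arguments interior_product {R m M r A k} X w x _.
#[local] Arguments dA {R m M r A k} w x _.
#[local] Arguments lie_form {R m M r A k} X _ x _.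
#[local] Arguments schouten {R m M r A k} X P x _.
#[local] Arguments leibniz_bracket {R m M r A p} Pi w z x _.

(** * Smooth functions on open subsets of $R^m$ *)

(** The Lie derivative of a form along X and the Schouten bracket of X with a multisection become
    one formula, [lie], once a multisection is read as a form on the dual bundle and the actions of
    X on functions and on sections are abstracted to a [derivation]. Tensoriality, the commutator
    identity and its consequence for multipliers are then proved once, and serve [mu] on A as well
    as [Pi] on the dual of A.

    The obstacle is that [dA] and [schouten] are definite descriptions: nothing is known about their
    values until a form with the prescribed values on global sections has been built. Frames live on
    open sets only, whereas the axioms of the bracket speak of global sections, so frames have to be
    replaced by global sections that agree with them near a point.

    The comparison of multipliers is pointwise: at each x one divides by a nonzero value at x of the
    form acted upon. A zero of [Pi] is therefore inspected on its own, and no density argument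
    enters. The sign $(-1)^n$ stays inside the factor $f_w$ and is never computed with. *)

Section Differentiability.
Context {R : realType} {m : nat}.
Implicit Types (U W : set 'rV[R]_m) (f g : 'rV[R]_m -> R).

Lemma Ck_sub k U W f : U `<=` W -> Ck k W f -> Ck k U f.
Proof.
elim: k f => [|k IH] f UW /= [cf df]; first by split=> // x /UW; exact: cf.
split=> [x /UW|]; first exact: cf.
case: df => df Df; split=> [v x /UW|v]; first exact: df.
by apply: IH => //; exact: Df.
Qed.

(** [Ck] is a condition at each single point of U on the total functions obtained by iterating
    ['D_v], so it can be checked point by point. *)
Lemma Ck_local k U f :
  (forall x, U x -> exists2 W, W x & Ck k W f) -> Ck k U f.
Proof.
elim: k f => [|k IH] f Uf; first by split=> // x /Uf[W Wx [cf _]]; exact: cf.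
split=> [x /Uf[W Wx [cf _]]|]; first exact: cf.
split=> [v x /Uf[W Wx [_ [df _]]]|v]; first exact: df.
by apply: IH => x /Uf[W Wx [_ [_ Df]]]; exists W => //; exact: Df.
Qed.

(** Openness turns equality on U into equality of germs, on which continuity and directional
    derivatives depend. *)
Lemma Ck_eq k U f g :
  open U -> (forall x, U x -> f x = g x) -> Ck k U f -> Ck k U g.
Proof.
move=> oU; elim: k f g => [|k IH] f g fg [cf df].
  split=> // x Ux; have fgx : \forall y \near x, f y = g y.
    by apply: filterS (open_nbhs_nbhs (conj oU Ux)) => y; exact: fg.
  by rewrite /prop_for /continuous_at -fg //; exact: cvg_trans (near_eq_cvg fgx) (cf x Ux).
have nfg x : U x -> \forall y \near x, f y = g y.
  by move=> Ux; apply: filterS (open_nbhs_nbhs (conj oU Ux)) => y; exact: fg.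
split=> [x Ux|].
  rewrite /prop_for /continuous_at -fg //.
  exact: cvg_trans (near_eq_cvg (nfg x Ux)) (cf x Ux).
case: df => df Df; split=> [v x Ux|v].
  by apply: near_eq_derivable (df v x Ux); exact: nfg.
apply: IH (Df v) => x Ux; apply: near_eq_derive.
  exact: nfg.
Qed.

Lemma CkS k U f : Ck k.+1 U f -> Ck k U f.
Proof.
elim: k f => [|k IH] f [cf [df Df]]; first by split.
by split=> //; split=> // v; apply: IH; exact: Df.
Qed.

Lemma Ck_cst k U (c : R) : Ck k U (fun=> c).
Proof.
elim: k c => [|k IH] c.
  by split=> // x _; exact: cst_continuous.
split=> [x _|]; first exact: cst_continuous.
split=> [v x _|v]; first exact: derivable_cst.
have -> : 'D_v (fun=> c : R) = (fun=> 0) :> ('rV[R]_m -> R).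
  by apply/funext => x; rewrite derive_cst.
exact: IH.
Qed.

Lemma CkD k U f g : open U -> Ck k U f -> Ck k U g -> Ck k U (fun x => f x + g x).
Proof.
move=> oU; elim: k f g => [|k IH] f g [cf df] [cg dg].
  by split=> // x Ux; apply: continuousD; [exact: cf|exact: cg].
split=> [x Ux|]; first by apply: continuousD; [exact: cf|exact: cg].
case: df dg => df Df [dg Dg]; split=> [v x Ux|v].
  by apply: derivableD; [exact: df|exact: dg].
apply: (@Ck_eq _ _ (fun x => 'D_v f x + 'D_v g x)) => // [x Ux|].
  by rewrite deriveD //; [exact: df|exact: dg].
by apply: IH; [exact: Df|exact: Dg].
Qed.

Lemma CkM k U f g : open U -> Ck k U f -> Ck k U g -> Ck k U (fun x => f x * g x).
Proof.
move=> oU; elim: k f g => [|k IH] f g kf kg.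
  by case: kf kg => cf _ [cg _]; split=> // x Ux; apply: continuousM; [exact: cf|exact: cg].
have [kf' kg'] := (CkS kf, CkS kg).
case: kf kg => cf [df Df] [cg [dg Dg]].
split=> [x Ux|]; first by apply: continuousM; [exact: cf|exact: cg].
split=> [v x Ux|v]; first by apply: derivableM; [exact: df|exact: dg].
apply: (@Ck_eq _ _ (fun x => f x * 'D_v g x + g x * 'D_v f x)) => // [x Ux|].
  by rewrite deriveM //; [exact: df|exact: dg].
by apply: CkD => //; apply: IH => //; [exact: Dg|exact: Df].
Qed.

Lemma CkV k U f : open U -> (forall x, U x -> f x != 0) -> Ck k U f ->
  Ck k U (fun x => (f x)^-1).
Proof.
move=> oU f0; elim: k => [|k IH] kf.
  by case: kf => cf _; split=> // x Ux; apply: continuousV; [exact: f0|exact: cf].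
have kf' := CkS kf.
case: kf => cf [df Df].
split=> [x Ux|]; first by apply: continuousV; [exact: f0|exact: cf].
split=> [v x Ux|v]; first by apply: derivableV; [exact: f0|exact: df].
apply: (@Ck_eq _ _ (fun x => -1 * ((f x)^-1 * (f x)^-1) * 'D_v f x)) => // [x Ux|].
  by rewrite deriveV ?f0 //; [rewrite mulN1r expr2 invfM|exact: df].
apply: CkM => //; last exact: Df.
by apply: CkM => //; [exact: Ck_cst|apply: CkM => //; exact: IH].
Qed.

(** [Ck] speaks of directional derivatives, not of differentiability, so the chain rule used is the
    one-variable one, along the line $t \mapsto tv + x$ at $t = 0$. *)
Lemma is_derive_comp (h : R -> R) f x v (a b : R) :
  is_derive (f x) (1 : R) h a -> is_derive x v f b ->
  is_derive x v (h \o f) (a * b).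
Proof.
move=> dh [df fb].
have lineE (q : 'rV[R]_m -> R) :
    (fun t : R => t^-1 *: (((fun s : R => q (s *: v + x)) \o shift 0) (t *: 1)
      - q (0 *: v + x))) = (fun t : R => t^-1 *: ((q \o shift x) (t *: v) - q x)).
  apply/funext => t /=; congr (_ *: (q _ - q _)).
    by rewrite addr0 [_ *: 1]mulr1.
  by rewrite scale0r add0r.
have dl : is_derive (0 : R) (1 : R) (fun t : R => f (t *: v + x)) b.
  split; first by rewrite /derivable lineE.
  by rewrite /derive lineE.
have fx : f (0 *: v + x) = f x by rewrite scale0r add0r.
rewrite -fx in dh.
have [dhf hfab] := @is_derive1_comp _ h (fun t : R => f (t *: v + x)) 0 _ _ dh dl.
split.
  by move: dhf; rewrite /derivable (lineE (h \o f)).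
by move: hfab; rewrite /derive (lineE (h \o f)).
Qed.

(* [flat n] is $e^{-1/t}/t^n$ extended by 0; the family is closed under
   differentiation, which gives smoothness. *)
Definition flat (n : nat) (t : R) : R :=
  if 0 < t then expR (- t^-1) * t^-1 ^+ n else 0.

Lemma flat_ge0 n t : 0 <= flat n t.
Proof.
by rewrite /flat; case: ifP => // t0; rewrite mulr_ge0 ?expR_ge0 // exprn_ge0 // invr_ge0 ltW.
Qed.

Lemma flat_gt0 n t : 0 < t -> 0 < flat n t.
Proof. by move=> t0; rewrite /flat t0 mulr_gt0 ?expR_gt0 // exprn_gt0 // invr_gt0. Qed.

(** With $u = 1/t$ this is $e^u \ge u^{n+1}/(n+1)!$. It controls the difference quotient of [flat n]
    at 0, which is [flat n.+1]. *)
Lemma flat_le n (t : R) : flat n t <= n.+1`!%:R * `|t|.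
Proof.
rewrite /flat; case: ifPn => [t0|_]; last by rewrite mulr_ge0.
rewrite gtr0_norm // expRN.
have u0 : 0 < t^-1 by rewrite invr_gt0.
have := @expR_ge1Dxn R _ n (ltW u0) => le.
have {}le : t^-1 ^+ n.+1 / n.+1`!%:R <= expR t^-1 by apply: le_trans le; rewrite lerDr.
have fp : 0 < n.+1`!%:R :> R by rewrite ltr0n fact_gt0.
rewrite ler_pdivrMr // exprSr ler_pdivrMr // mulrAC in le.
by rewrite [leLHS]mulrC ler_pdivrMr ?expR_gt0 // -mulrA [leRHS]mulrC [t * _]mulrC.
Qed.

Lemma flatS n (t : R) : t != 0 -> t^-1 * flat n t = flat n.+1 t.
Proof.
by rewrite /flat; case: ifP => // _ _; rewrite ?mulr0 // exprS mulrCA.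
Qed.

Lemma flat_le0 n (t : R) : t <= 0 -> flat n t = 0.
Proof. by rewrite /flat ltNge => ->. Qed.

Lemma is_derive_flat n (t : R) :
  is_derive t (1 : R) (flat n) (flat n.+2 t - n%:R * flat n.+1 t).
Proof.
have [t0|t0|->] := ltrgt0P t.
- pose g (s : R) : R := expR (- s^-1) * s^-1 ^+ n.
  apply: (near_eq_is_derive (f := g)).
    by near=> s; rewrite /flat ifT //; near: s; exact: lt_nbhsr.
  rewrite /flat t0.
  have dV : is_derive t (1 : R) (fun s : R => s^-1) (- t ^- 2 *: 1).
    by apply: is_deriveV; rewrite gt_eqF.
  have dE : is_derive t (1 : R) (fun s : R => expR (- s^-1)) (expR (- t^-1) * t^- 2).
    apply: (@is_derive1_comp _ expR (fun s => - s^-1)).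
    by apply: is_derive_eq; rewrite -scaleNr opprK; exact: mulr1.
  have dX := is_deriveX n dV.
  have -> : g = (fun s : R => expR (- s^-1)) * (fun s : R => s^-1) ^+ n.
    by apply/funext => s; rewrite /g fctE; congr (_ * _); rewrite exprfctE.
  apply: is_derive_eq (is_deriveM dE dX) _.
  rewrite exprfctE /= -!exprVn /GRing.scale /=.
  by case: n {g dX} => [|n] /=; rewrite ?mulr0n -?natr1 !exprS; ring.
- apply: (near_eq_is_derive (f := cst 0 : R -> R)).
    by near=> s; rewrite flat_le0 //; apply/ltW; near: s; exact: lt_nbhsl.
  by rewrite !flat_le0 ?(ltW t0) // mulr0 subr0; exact: is_derive_cst.
rewrite !flat_le0 // mulr0 subr0.
have lim0 : h^-1 *: ((flat n \o shift 0) (h *: (1 : R)) - flat n 0) @[h --> (0 : R)^'] --> (0 : R).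
  apply: (@squeeze_cvgr _ _ _ _ (fun=> 0) (fun h => n.+2`!%:R * `|h|)).
  - near=> h; have h0 : h != 0 by near: h; exact: nbhs_dnbhs_neq.
    rewrite /= [flat n 0]flat_le0 // subr0 addr0 [h *: 1]mulr1 [_ *: _]flatS //.
    by rewrite flat_ge0 flat_le.
  - exact: cvg_cst.
  - rewrite -[X in _ --> X](mulr0 n.+2`!%:R) -[X in _ * X](normr0 R).
    apply: cvgMl_tmp; apply: cvg_norm; exact: (@cvg_within _ (nbhs (0 : R))).
split; first by apply/cvg_ex; exists 0.
exact: cvg_lim.
Unshelve. all: by end_near.
Qed.

Lemma Ck_flat k n U f : open U -> Ck k U f -> Ck k U (flat n \o f).
Proof.
move=> oU; elim: k n => [|k IH] n kf.
  case: kf => cf _; split=> // x Ux; apply: continuous_comp; first exact: cf.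
  by apply: differentiable_continuous; apply/derivable1_diffP; case: (is_derive_flat n (f x)).
have kf' := CkS kf.
case: kf => cf [df Df]; split=> [x Ux|].
  apply: continuous_comp; first exact: cf.
  by apply: differentiable_continuous; apply/derivable1_diffP; case: (is_derive_flat n (f x)).
have isd v x : U x -> is_derive x v (flat n \o f)
    ((flat n.+2 (f x) - n%:R * flat n.+1 (f x)) * 'D_v f x).
  move=> Ux; apply: is_derive_comp; first exact: is_derive_flat.
  by apply: DeriveDef => //; exact: df.
split=> [v x /(isd v)[]|v] //.
apply: (@Ck_eq _ _ (fun x =>
    ((flat n.+2 \o f) x + - n%:R * (flat n.+1 \o f) x) * 'D_v f x)) => // [x /(isd v)[_ ->]|].
  by rewrite /= mulNr.
apply: CkM => //; last exact: Df.
apply: CkD => //; first exact: IH.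
by apply: CkM => //; [exact: Ck_cst|exact: IH].
Qed.

End Differentiability.

(** * Cut-off functions *)

Section Step.
Context {R : realType} {m : nat}.

Lemma Ck_sum (I : Type) (s : seq I) k (U : set 'rV[R]_m) (f : I -> 'rV[R]_m -> R) :
  open U -> (forall i, Ck k U (f i)) -> Ck k U (fun x => \sum_(i <- s) f i x).
Proof.
move=> oU kf; elim: s => [|i s IH].
  by apply: (Ck_eq oU _ (Ck_cst k U 0)) => x _; rewrite big_nil.
by apply: (Ck_eq oU _ (CkD oU (kf i) IH)) => x _; rewrite big_cons.
Qed.

Definition step (t : R) : R := flat 0 t / (flat 0 t + flat 0 (1 - t)).

(** The numbers t and 1 - t are never both nonpositive. *)
Lemma step_denom (t : R) : flat 0 t + flat 0 (1 - t) != 0.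
Proof.
have [t0|t0] := ltP 0 t; rewrite gt_eqF //.
  by rewrite ltr_wpDr ?flat_ge0 ?flat_gt0.
by rewrite ltr_wpDl ?flat_ge0 ?flat_gt0 //; lra.
Qed.

Lemma step1 (t : R) : 1 <= t -> step t = 1.
Proof.
move=> t1; have := step_denom t; rewrite /step (@flat_le0 _ 0 (1 - t)) ?addr0; last lra.
exact: divff.
Qed.

Lemma step0 (t : R) : t <= 0 -> step t = 0.
Proof. by move=> t0; rewrite /step flat_le0 // mul0r. Qed.

Lemma Ck_step k (U : set 'rV[R]_m) f : open U -> Ck k U f -> Ck k U (step \o f).
Proof.
move=> oU kf; apply: CkM => //; first exact: (@Ck_flat _ _ _ 0).
apply: CkV => // [x _|]; first exact: step_denom.
apply: CkD => //; first exact: (@Ck_flat _ _ _ 0).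
apply: (@Ck_flat _ _ _ 0 _ (fun x => 1 - f x)) => //.
apply: CkD => //; first exact: Ck_cst.
apply: (Ck_eq oU _ (CkM oU (Ck_cst k U (-1)) kf)) => x _; by rewrite mulN1r.
Qed.

(* At least 1 when $|t-c|^2 \le e^2/4$, at most 0 when $|t-c|^2 \ge e^2/2$. *)
Definition radius (c : 'rV[R]_m) (e : R) (t : 'I_m -> R) : R :=
  2 - (\sum_a (t a - c ord0 a) ^+ 2) * (4 / e ^+ 2).

Definition radial_step c e t : R := step (radius c e t).

(** The coordinates t are arbitrary [Ck] functions, so that a cut-off built in one chart can be read
    in another one through the transition functions. *)
Lemma Ck_radius k (U : set 'rV[R]_m) (c : 'rV[R]_m) (e : R)
    (t : 'I_m -> 'rV[R]_m -> R) :
  open U -> (forall a, Ck k U (t a)) ->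
  Ck k U (fun y => radius c e (t^~ y)).
Proof.
move=> oU kt.
apply: (@Ck_eq _ _ _ _ (fun y => 2 +
  (\sum_a (t a y + (- c ord0 a)) * (t a y + (- c ord0 a))) * (- (4 / e ^+ 2)))) => //.
  by move=> y _; rewrite mulrN; congr (_ - _ * _); apply: eq_bigr => a _; rewrite expr2.
apply: CkD => //; first exact: Ck_cst.
apply: CkM => //; last exact: Ck_cst.
apply: Ck_sum => // a.
by apply: CkM => //; apply: CkD => //; exact: Ck_cst.
Qed.

Lemma Ck_radial_step k (U : set 'rV[R]_m) (c : 'rV[R]_m) (e : R)
    (t : 'I_m -> 'rV[R]_m -> R) :
  open U -> (forall a, Ck k U (t a)) ->
  Ck k U (fun y => radial_step c e (t^~ y)).
Proof. by move=> oU kt; apply: Ck_step => //; exact: Ck_radius. Qed.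

End Step.

(** * Smooth functions on the manifold and bump functions *)

Section SmoothFunctions.
Context {R : realType} {m : nat} {M : manifold R m}.
Implicit Types (V W : set M) (f g : M -> R).

Lemma chart_image_openI (i : chart_index M) W :
  open W -> open (chart i @` (chart_dom i `&` W)).
Proof.
move=> oW; rewrite openE => y [x [dx Wx] <-] /=.
have cx : (chart i @` chart_dom i) (chart i x) by exists x.
have nx : nbhs (chart_inv i (chart i x)) W.
  by rewrite chartK //; exact: open_nbhs_nbhs.
have n1 : \forall z \near chart i x, W (chart_inv i z) := chart_inv_continuous cx nx.
have n2 := open_nbhs_nbhs (conj (@chart_image_open _ _ M i) cx).
apply: filterS2 n1 n2 => y' /= Wy [z dz zy]; exists z => //; split=> //.
by move: Wy; rewrite -zy chartK.
Qed.

Lemma smooth_on_sub V W f : V `<=` W -> smooth_on W f -> smooth_on V f.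
Proof.
by move=> VW sf i k; apply: Ck_sub (sf i k) => _ [x [dx /VW Wx] <-]; exists x.
Qed.

Lemma smooth_on_local V f :
  (forall x, V x -> exists2 W, W x & smooth_on W f) -> smooth_on V f.
Proof.
move=> Vf i k; apply: Ck_local => _ [x [dx Vx] <-].
have [W Wx sf] := Vf x Vx.
by exists (chart i @` (chart_dom i `&` W)); [exists x|exact: sf].
Qed.

Lemma smooth_onW V f : smooth f -> smooth_on V f.
Proof. by apply: smooth_on_sub => x. Qed.

Lemma smooth_local f : (forall x, exists2 W, W x & smooth_on W f) -> smooth f.
Proof. by move=> fl; apply: smooth_on_local => x _; exact: fl. Qed.

Lemma smooth_on_eq V f g :
  open V -> (forall x, V x -> f x = g x) -> smooth_on V f -> smooth_on V g.
Proof.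
move=> oV fg sf i k; apply: Ck_eq (sf i k); first exact: chart_image_openI.
by move=> _ [x [dx Vx] <-] /=; rewrite chartK // fg.
Qed.

Lemma smooth_eq f g : (forall x, f x = g x) -> smooth f -> smooth g.
Proof. by move=> /funext ->. Qed.

Lemma smooth_on_cst V (c : R) : smooth_on V (fun=> c).
Proof. by move=> i k; exact: Ck_cst. Qed.

Lemma smooth_onD V f g : open V -> smooth_on V f -> smooth_on V g ->
  smooth_on V (fun x => f x + g x).
Proof. by move=> oV sf sg i k; apply: CkD; [exact: chart_image_openI|exact: sf|exact: sg]. Qed.

Lemma smooth_onM V f g : open V -> smooth_on V f -> smooth_on V g ->
  smooth_on V (fun x => f x * g x).
Proof. by move=> oV sf sg i k; apply: CkM; [exact: chart_image_openI|exact: sf|exact: sg]. Qed.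

Lemma smooth_onN V f : open V -> smooth_on V f -> smooth_on V (fun x => - f x).
Proof.
move=> oV sf; apply: (smooth_on_eq oV _ (smooth_onM oV (smooth_on_cst V (-1)) sf)) => x _.
by rewrite mulN1r.
Qed.

Lemma smooth_on_sum (I : Type) (s : seq I) (P : pred I) V (f : I -> M -> R) :
  open V -> (forall i, smooth_on V (f i)) -> smooth_on V (fun x => \sum_(i <- s | P i) f i x).
Proof.
move=> oV sf; elim: s => [|i s IH].
  by apply: (smooth_on_eq oV _ (smooth_on_cst V 0)) => x _; rewrite big_nil.
case Pi : (P i); last by apply: (smooth_on_eq oV _ IH) => x _; rewrite big_cons Pi.
by apply: (smooth_on_eq oV _ (smooth_onD oV (sf i) IH)) => x _; rewrite big_cons Pi.
Qed.

Lemma smooth_on_prod (I : Type) (s : seq I) (P : pred I) V (f : I -> M -> R) :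
  open V -> (forall i, smooth_on V (f i)) -> smooth_on V (fun x => \prod_(i <- s | P i) f i x).
Proof.
move=> oV sf; elim: s => [|i s IH].
  by apply: (smooth_on_eq oV _ (smooth_on_cst V 1)) => x _; rewrite big_nil.
case Pi : (P i); last by apply: (smooth_on_eq oV _ IH) => x _; rewrite big_cons Pi.
by apply: (smooth_on_eq oV _ (smooth_onM oV (sf i) IH)) => x _; rewrite big_cons Pi.
Qed.

Lemma smoothD f g : smooth f -> smooth g -> smooth (fun x => f x + g x).
Proof. exact: smooth_onD openT. Qed.

Lemma smoothM f g : smooth f -> smooth g -> smooth (fun x => f x * g x).
Proof. exact: smooth_onM openT. Qed.

Lemma smoothN f : smooth f -> smooth (fun x => - f x).
Proof. exact: smooth_onN openT. Qed.

Lemma smooth_cst (c : R) : smooth (fun _ : M => c).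
Proof. exact: smooth_on_cst. Qed.

Lemma smooth_sum (I : Type) (s : seq I) (P : pred I) (f : I -> M -> R) :
  (forall i, smooth (f i)) -> smooth (fun x => \sum_(i <- s | P i) f i x).
Proof. exact: smooth_on_sum openT. Qed.

(** The closed set C inside V that carries phi is what allows phi f to be extended smoothly by 0
    when f is smooth on V only. *)
Lemma exists_bump (x : M) V : open V -> V x -> exists (phi : M -> R) (C : set M),
  [/\ smooth phi, \forall y \near x, phi y = 1, closed C, C `<=` V &
      forall y, ~ C y -> phi y = 0].
Proof.
move=> oV Vx; have [i dx] := chart_cover x.
pose U := chart i @` (chart_dom i `&` V); pose c := chart i x.
have oU : open U by exact: chart_image_openI.
have Uc : U c by exists x.
have /nbhs_ballP[e /= e0 eU] := open_nbhs_nbhs (conj oU Uc).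
pose phi0 (y : 'rV[R]_m) := radial_step c e (fun a => y ord0 a).
(* The half-width $3e/4$ lies between $e/\sqrt{2}$, beyond which [radius] is nonpositive, and e, the
   radius of a ball (for the sup norm) inside U. *)
pose K := [set y : 'rV[R]_m | forall a,
  `[c ord0 a - e * (3 / 4), c ord0 a + e * (3 / 4)]%classic (y ord0 a)].
have cK : compact K.
  apply: (@rV_compact _ _ (fun a =>
    `[c ord0 a - e * (3 / 4), c ord0 a + e * (3 / 4)]%classic)) => a.
  exact: segment_compact.
have KU : K `<=` U.
  move=> y Ky; apply: eU; split=> // i0 a; rewrite ord1 {i0}.
  have := Ky a; rewrite /= in_itv /= /ball /= => /andP[h1 h2].
  rewrite ltr_norml; apply/andP; split; lra.
have phi0K y : ~ K y -> phi0 y = 0.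
  move=> nK; apply: step0.
  have {nK} [a] : exists a, ~ `[c ord0 a - e * (3 / 4), c ord0 a + e * (3 / 4)]%classic (y ord0 a).
    by apply/existsNP.
  rewrite /= in_itv /= => /negP hh.
  have big : e ^+ 2 * (1 / 2) <= \sum_a (y ord0 a - c ord0 a) ^+ 2.
    rewrite (bigD1 a) //= -[leLHS]addr0; apply: lerD; last first.
      by apply: sumr_ge0 => b _; exact: sqr_ge0.
    by move: hh; rewrite negb_and -!ltNge => /orP[]; nra.
  have e2 : 0 < e ^+ 2 by rewrite exprn_gt0.
  rewrite subr_le0 mulrA ler_pdivlMr //; lra.
pose phi z := if `[< chart_dom i z >] then phi0 (chart i z) else 0.
pose C := chart_inv i @` K.
have CV : C `<=` chart_dom i `&` V.
  by move=> _ [y /KU[z [dz Vz] <-] <-]; rewrite chartK.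
(* Compactness of the cube passes to its image in M, which is closed because M is Hausdorff; being
   closed in the chart domain would not be enough to extend by 0. *)
have clC : closed C.
  apply: compact_closed; first exact: manifold_hausdorff.
  apply: continuous_compact => //; apply: continuous_in_subspaceT => y.
  by rewrite inE => /KU[z [dz Vz] zy]; apply: chart_inv_continuous; exists z.
have phiC z : ~ C z -> phi z = 0.
  rewrite /phi; case: asboolP => // dz nC; apply: phi0K => Kz; apply: nC.
  by exists (chart i z) => //; exact: chartK.
exists phi, C; split=> //; last by move=> z /CV[].
- apply: smooth_local => z; have [Cz|nC] := pselect (C z); last first.
    exists (~` C) => //; apply: (@smooth_on_eq _ (fun=> 0)); first exact: closed_openC.
      by move=> y /phiC.
    exact: smooth_on_cst.
  exists (chart_dom i); first by have [] := CV z Cz.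
  move=> j k.
  have oI : open (chart j @` (chart_dom j `&` chart_dom i)).
    by apply: chart_image_openI; exact: chart_dom_open.
  apply: (@Ck_eq _ _ _ _ (fun y => radial_step c e (fun a => chart i (chart_inv j y) ord0 a))) => //.
    by move=> _ [w [djw diw] <-] /=; rewrite chartK // /phi; case: asboolP.
  by apply: Ck_radial_step => // a; exact: chart_transition.
- have q0 : \forall y \near c, phi0 y = 1.
    have [cr _] : Ck 0 setT (fun y : 'rV[R]_m => radius c e (fun a => y ord0 a)).
      apply: Ck_radius => [|a]; first exact: openT.
      by split=> // y _; exact: coord_continuous.
    have rc : 1 < radius c e (fun a => c ord0 a).
      rewrite /radius big1 => [|a _]; last by rewrite subrr expr0n.
      by rewrite mul0r; lra.
    have := cr c I => /(@cvgr_gt _ _ _ _ _ _) /(_ _ rc).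
    by apply: filterS => y /ltW; exact: step1.
  have n1 : \forall z \near x, phi0 (chart i z) = 1 := chart_continuous dx q0.
  have n2 := open_nbhs_nbhs (conj (@chart_dom_open _ _ M i) dx).
  apply: filterS2 n2 n1 => z dz /= q1.
  by rewrite /phi; case: asboolP.
Qed.

End SmoothFunctions.

(** * Tensorial maps on sections of a vector bundle *)

Lemma dfwith_fun (k : nat) (T S : Type) (g : T -> S) (X : 'I_k -> T) i Y :
  (fun a => g (dfwith X i Y a)) = dfwith (fun a => g (X a)) i (g Y).
Proof.
apply/funext => a; have [<-|ia] := eqVneq i a; first by rewrite !dfwithin.
by rewrite !dfwithout.
Qed.

Lemma dfwith_id (k : nat) (T : Type) (X : 'I_k -> T) i : dfwith X i (X i) = X.
Proof.
apply/funext => a; have [<-|ia] := eqVneq i a; first by rewrite dfwithin.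
by rewrite dfwithout.
Qed.

Lemma dfwith_P (k : nat) (T : Type) (P : T -> Prop) (X : 'I_k -> T) i Y :
  (forall a, P (X a)) -> P Y -> forall a, P (dfwith X i Y a).
Proof.
move=> PX PY a; have [<-|ia] := eqVneq i a; first by rewrite dfwithin.
by rewrite dfwithout.
Qed.

Section Bundle.
Context {R : realType} {m : nat} {M : manifold R m} {r : nat} (E : vbundle M r).
Implicit Types (X Y Z : sect E) (f g : M -> R).

Lemma frame_coord (j : frame_index E) x (v : E x) : frame_dom j x ->
  v = \sum_a coord (frame j x) a v *: tnth (frame j x) a.
Proof.
move=> dx; rewrite [LHS](coord_basis (frame_basis dx)) ?memvf //.
by apply: eq_bigr => a _; rewrite (tnth_nth 0).
Qed.

Lemma coord_frame (j : frame_index E) x a b : frame_dom j x ->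
  coord (frame j x) a (tnth (frame j x) b) = (b == a)%:R.
Proof.
move=> dx; rewrite (tnth_nth 0) coord_free //.
exact: basis_free (frame_basis dx).
Qed.

Lemma smooth_sect_lin f X Y : smooth f -> smooth_sect X -> smooth_sect Y ->
  smooth_sect (fun x => f x *: X x + Y x).
Proof.
move=> sf sX sY j a; have oj := @frame_dom_open _ _ _ _ E j.
apply: (@smooth_on_eq _ _ _ _ (fun x => f x * coord (frame j x) a (X x) + coord (frame j x) a (Y x))) => //.
  by move=> x _; rewrite linearP.
by apply: smooth_onD => //; apply: smooth_onM => //; exact: smooth_onW.
Qed.

Lemma smooth_sect0 : smooth_sect (fun x => 0 : E x).
Proof.
move=> j a; have oj := @frame_dom_open _ _ _ _ E j.
by apply: (smooth_on_eq oj _ (smooth_on_cst _ 0)) => x _; rewrite linear0.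
Qed.

Lemma smooth_sectD X Y : smooth_sect X -> smooth_sect Y ->
  smooth_sect (fun x => X x + Y x).
Proof.
move=> sX sY; have := smooth_sect_lin (smooth_cst 1) sX sY.
by congr smooth_sect; apply: functional_extensionality_dep => x; rewrite scale1r.
Qed.

Lemma smooth_sectZ f X : smooth f -> smooth_sect X ->
  smooth_sect (fun x => f x *: X x).
Proof.
move=> sf sX; have := smooth_sect_lin sf sX smooth_sect0.
by congr smooth_sect; apply: functional_extensionality_dep => x; rewrite addr0.
Qed.

Lemma smooth_sectN X : smooth_sect X -> smooth_sect (fun x => - X x).
Proof.
move=> sX; have := smooth_sectZ (smooth_cst (-1)) sX.
by congr smooth_sect; apply: functional_extensionality_dep => x; rewrite scaleN1r.
Qed.

Lemma smooth_sect_sum (I : Type) (s : seq I) (X : I -> sect E) :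
  (forall i, smooth_sect (X i)) -> smooth_sect (fun x => \sum_(i <- s) X i x).
Proof.
move=> sX; elim: s => [|i s IH].
  have := smooth_sect0; congr smooth_sect.
  by apply: functional_extensionality_dep => x; rewrite big_nil.
have := smooth_sectD (sX i) IH; congr smooth_sect.
by apply: functional_extensionality_dep => x; rewrite big_cons.
Qed.

(** Off C the product is 0, on V both factors are smooth, and these two open sets cover W. *)
Lemma smooth_bumpM (phi f : M -> R) (C V W : set M) :
  smooth phi -> closed C -> open V -> open W -> (forall y, ~ C y -> phi y = 0) ->
  C `&` W `<=` V -> smooth_on V f -> smooth_on W (fun y => phi y * f y).
Proof.
move=> sphi cC oV oW phi0 CV sf; apply: smooth_on_local => x Wx.
have [Cx|nC] := pselect (C x).
  by exists V; [exact: CV|apply: smooth_onM => //; exact: smooth_onW].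
exists (~` C) => //; apply: (@smooth_on_eq _ _ _ _ (fun=> 0)).
- exact: closed_openC.
- by move=> y /phi0 ->; rewrite mul0r.
- exact: smooth_on_cst.
Qed.

(** Frame vectors and coordinates are both multiplied by phi to become global, whence the square of
    phi in the decomposition of X. *)
Lemma local_frame (j : frame_index E) (x : M) : frame_dom j x ->
  exists (phi : M -> R) (Y : 'I_r -> sect E),
  [/\ phi x = 1, forall a, smooth_sect (Y a),
      \forall y \near x, frame_dom j y /\ forall a, Y a y = tnth (frame j y) a,
      smooth phi &
      forall X, smooth_sect X ->
        (forall a, smooth (fun y => phi y * coord (frame j y) a (X y))) /\
        forall y, \sum_a (phi y * coord (frame j y) a (X y)) *: Y a y =
                  phi y ^+ 2 *: X y].
Proof.
move=> dx; have oj := @frame_dom_open _ _ _ _ E j.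
have [phi [C [sphi phi1 cC CV phi0]]] := exists_bump oj dx.
exists phi, (fun a y => phi y *: tnth (frame j y) a); split=> //.
- exact: nbhs_singleton phi1.
- move=> a j' b; have oj' := @frame_dom_open _ _ _ _ E j'.
  apply: (@smooth_on_eq _ _ _ _ (fun y => phi y * coord (frame j' y) b (tnth (frame j y) a))) => //.
    by move=> y _; rewrite linearZ.
  apply: (@smooth_bumpM _ _ C (frame_dom j `&` frame_dom j')) => //.
  - exact: openI.
  - by move=> y [/CV].
  - exact: frame_transition.
- have := open_nbhs_nbhs (conj oj dx).
  by apply: filterS2 phi1 => y phi1 dy; split=> // a; rewrite phi1 scale1r.
- move=> X sX; split=> [a|y].
    apply: (@smooth_bumpM _ _ C (frame_dom j)) => //; first exact: openT.
    by move=> y [/CV].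
  have [Cy|nC] := pselect (C y); last first.
    by rewrite phi0 // expr0n scale0r big1 // => a _; rewrite mul0r scale0r.
  rewrite {2}(frame_coord (X y) (CV _ Cy)) scaler_sumr; apply: eq_bigr => a _.
  by rewrite !scalerA expr2; congr (_ *: _); rewrite mulrAC.
Qed.

Lemma sect_through (x : M) (v : E x) : exists2 X, smooth_sect X & X x = v.
Proof.
have [j dx] := frame_cover E x.
have [phi [Y [_ sY nY _ _]]] := local_frame dx.
exists (fun y => \sum_a coord (frame j x) a v *: Y a y).
  apply: smooth_sect_sum => a.
  by apply: (@smooth_sectZ (fun=> coord (frame j x) a v)) => //; exact: smooth_cst.
rewrite [RHS](frame_coord v dx); apply: eq_bigr => a _.
by have [_ ->] := nbhs_singleton nY.
Qed.

Definition ext (x : M) (v : E x) : sect E := projT1 (cid2 (sect_through v)).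

Lemma smooth_ext (x : M) (v : E x) : smooth_sect (ext v).
Proof. by rewrite /ext; case: cid2. Qed.

Lemma extE (x : M) (v : E x) : ext v x = v.
Proof. by rewrite /ext; case: cid2. Qed.

(** If Z vanishes at x, then in $Z = \sum_a (\phi c_a) Y_a + (1 - \phi^2) Z$, given by
    [local_frame], every coefficient vanishes at x, so T Z = 0. *)
Lemma sect_tensor_local (x : M) (T : sect E -> R) :
  (forall f X Y, smooth f -> smooth_sect X -> smooth_sect Y ->
    T (fun y => f y *: X y + Y y) = f x * T X + T Y) ->
  forall X Y, smooth_sect X -> smooth_sect Y -> X x = Y x -> T X = T Y.
Proof.
move=> Tlin.
have T0 : T (fun y => 0) = 0.
  have := Tlin (fun=> -1) _ _ (smooth_cst (-1)) smooth_sect0 smooth_sect0.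
  rewrite mulN1r addNr => <-; congr T.
  by apply: functional_extensionality_dep => y; rewrite scaler0 addr0.
have Tsum (I : Type) (s : seq I) (g : I -> M -> R) (Y : I -> sect E) Z :
    (forall i, smooth (g i)) -> (forall i, smooth_sect (Y i)) -> smooth_sect Z ->
    T (fun y => \sum_(i <- s) g i y *: Y i y + Z y) = \sum_(i <- s) g i x * T (Y i) + T Z.
  move=> sg sY sZ; elim: s => [|i s IH].
    rewrite big_nil add0r; congr T.
    by apply: functional_extensionality_dep => y; rewrite big_nil add0r.
  rewrite big_cons -addrA -IH -Tlin //; last first.
    apply: smooth_sectD => //; apply: smooth_sect_sum => i'; exact: smooth_sectZ.
  by congr T; apply: functional_extensionality_dep => y; rewrite big_cons addrA.
have Tz Z : smooth_sect Z -> Z x = 0 -> T Z = 0.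
  move=> sZ Zx; have [j dx] := frame_cover E x.
  have [phi [Y [phi1 sY nY sphi dec]]] := local_frame dx.
  have [sc ce] := dec _ sZ.
  have s1 : smooth (fun y => 1 - phi y * phi y).
    by apply: smoothD; [exact: smooth_cst|apply: smoothN; exact: smoothM].
  have -> : Z = fun y => \sum_a (phi y * coord (frame j y) a (Z y)) *: Y a y + (1 - phi y * phi y) *: Z y.
    apply: functional_extensionality_dep => y.
    by rewrite ce scalerBl scale1r expr2 addrCA subrr addr0.
  rewrite (Tsum _ _ (fun a y => phi y * coord (frame j y) a (Z y))) //; last exact: smooth_sectZ.
  rewrite big1 => [|a _]; last by rewrite Zx linear0 mulr0 mul0r.
  have -> : (fun y => (1 - phi y * phi y) *: Z y) = fun y => (1 - phi y * phi y) *: Z y + 0.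
    by apply: functional_extensionality_dep => y; rewrite addr0.
  rewrite Tlin //; last exact: smooth_sect0.
  by rewrite phi1 mulr1 subrr mul0r T0 !addr0.
move=> X Y sX sY XY.
have sXY : smooth_sect (fun y => X y - Y y).
  by apply: smooth_sectD => //; exact: smooth_sectN.
have -> : X = fun y => 1 *: (X y - Y y) + Y y.
  by apply: functional_extensionality_dep => y; rewrite scale1r subrK.
rewrite (Tlin (fun=> 1)) //; last exact: smooth_cst.
by rewrite Tz ?mulr0 ?add0r // XY subrr.
Qed.

(** The conditions bear on smooth sections only, where differential formulas are meaningful.
    Alternation is asked for sections that are equal everywhere, which is all that such a formula
    gives directly. *)
Definition tensorial (k : nat) (T : ('I_k -> sect E) -> M -> R) : Prop :=
  [/\ forall X : 'I_k -> sect E, (forall i, smooth_sect (X i)) -> smooth (T X),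
      forall (X : 'I_k -> sect E) i f Y Z, (forall i, smooth_sect (X i)) -> smooth f ->
        smooth_sect Y -> smooth_sect Z -> forall x,
        T (dfwith X i (fun y => f y *: Y y + Z y)) x =
        f x * T (dfwith X i Y) x + T (dfwith X i Z) x &
      forall (X : 'I_k -> sect E) i j, (forall i, smooth_sect (X i)) -> i != j -> X i = X j ->
        forall x, T X x = 0].

Lemma tensorial_local (k : nat) (T : ('I_k -> sect E) -> M -> R) (X Y : 'I_k -> sect E) (x : M) :
  tensorial T -> (forall i, smooth_sect (X i)) -> (forall i, smooth_sect (Y i)) ->
  (forall i, X i x = Y i x) -> T X x = T Y x.
Proof.
move=> [_ Tlin _] sX sY XY.
(* One argument is replaced at a time: [H n] takes the first n from Y and the others from X. *)
pose H n (i : 'I_k) : sect E := if (i < n)%N then Y i else X i.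
have sH n i : smooth_sect (H n i) by rewrite /H; case: ifP.
have HS n : (n <= k)%N -> T (H n) x = T X x.
  elim: n => [|n IH] nk; first by congr (T _ x).
  rewrite -IH; last exact: ltnW.
  have -> : H n.+1 = dfwith (H n) (Ordinal nk) (Y (Ordinal nk)).
    apply/funext => i; rewrite /H ltnS leq_eqVlt; have [ni|ni] := eqVneq (Ordinal nk) i.
      by rewrite -ni dfwithin eqxx.
    rewrite dfwithout // (_ : (i == n :> nat) = false) //.
    by apply/negbTE; apply: contra_neq ni => ni; apply: val_inj.
  have {2}-> : H n = dfwith (H n) (Ordinal nk) (X (Ordinal nk)).
    by rewrite -[in LHS](dfwith_id (H n) (Ordinal nk)) {2}/H ltnn.
  apply: (@sect_tensor_local x (fun Z => T (dfwith (H n) (Ordinal nk) Z) x)) => //.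
  by move=> f Z Z' sf sZ sZ'; exact: Tlin.
rewrite -(HS k (leqnn k)); congr (T _ x).
by apply/funext => i; rewrite /H ltn_ord.
Qed.

Lemma smooth_form_eval (k : nat) (w : kform E k) (X : 'I_k -> sect E) :
  smooth_form w -> (forall i : 'I_k, smooth_sect (X i)) ->
  smooth (fun x => w x (fun i => X i x)).
Proof.
move=> [walt sw] sX; apply: smooth_local => x.
have [j dx] := frame_cover E x; have oj := @frame_dom_open _ _ _ _ E j.
exists (frame_dom j) => //.
apply: (@smooth_on_eq _ _ _ _ (fun y => \sum_(I : {ffun 'I_k -> 'I_r})
   (\prod_a coord (frame j y) (I a) (X a y)) * w y (fun a => tnth (frame j y) (I a)))) => //.
  move=> y dy; rewrite -[LHS](multilinear_sum (fun a => tnth (frame j y) a)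
    (fun i a => coord (frame j y) a (X i y)) (walt y).1).
  by congr (w y); apply/funext => i; rewrite [RHS](frame_coord _ dy).
apply: smooth_on_sum => // I; apply: smooth_onM => //.
by apply: smooth_on_prod => // a; exact: sX.
Qed.

(** Near each point the frame vectors coincide with global smooth sections, by [local_frame]. *)
Lemma smooth_formP (k : nat) (w : kform E k) :
  (forall x, altmap (w x)) ->
  (forall X : 'I_k -> sect E, (forall i, smooth_sect (X i)) ->
    smooth (fun x => w x (fun i => X i x))) ->
  smooth_form w.
Proof.
move=> walt sw; split=> // j I; have oj := @frame_dom_open _ _ _ _ E j.
apply: smooth_on_local => x dx.
have [phi [Y [_ sY nY _ _]]] := local_frame dx.
move: nY; rewrite /prop_near1 nbhsE => -[W [oW Wx] WY].
exists W => //.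
apply: (@smooth_on_eq _ _ _ _ (fun x => w x (fun i => Y (I i) x))) => // [y Wy|].
  by congr (w y); apply/funext => i; have [_ ->] := WY y Wy.
by apply: smooth_onW; exact: sw.
Qed.

(** The vectors are extended to chosen global sections; [tensorial_local] removes the dependence on
    the choice. *)
Lemma tensorial_form (k : nat) (T : ('I_k -> sect E) -> M -> R) :
  tensorial T -> exists eta : kform E k, smooth_form eta /\
  forall X : 'I_k -> sect E, (forall i, smooth_sect (X i)) -> forall x, eta x (fun i => X i x) = T X x.
Proof.
move=> tT; pose eta : kform E k := fun x v => T (fun i => ext (v i)) x.
have etaE (X : 'I_k -> sect E) : (forall i, smooth_sect (X i)) -> forall x, eta x (fun i => X i x) = T X x.
  move=> sX x; apply: tensorial_local => // i; first exact: smooth_ext.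
  exact: extE.
have [Tsm Tlin Talt] := tT.
exists eta; split=> //; apply: smooth_formP => [x|X sX]; last first.
  by apply: smooth_eq (Tsm X sX) => x; rewrite etaE.
split=> [w i a u v|w i j ij wij]; last first.
  by apply: (Talt _ i j) => // [i'|]; [exact: smooth_ext|rewrite wij].
pose W i := ext (w i).
have sW i' : smooth_sect (W i') by exact: smooth_ext.
have evalW Z : smooth_sect Z -> eta x (dfwith w i (Z x)) = T (dfwith W i Z) x.
  move=> sZ; rewrite -etaE; last by apply: dfwith_P.
  congr (eta x); rewrite (dfwith_fun (fun Z : sect E => Z x)).
  by congr (dfwith _ i _); apply/funext => i'; rewrite /W extE.
have sl := smooth_sect_lin (smooth_cst a) (smooth_ext u) (smooth_ext v).
have := evalW _ sl; rewrite !extE => ->.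
rewrite (Tlin W i (fun=> a)) //; try exact: smooth_ext; last exact: smooth_cst.
by rewrite -!evalW ?extE //; exact: smooth_ext.
Qed.

Lemma form_ext (k : nat) (w z : kform E k) :
  (forall X : 'I_k -> sect E, (forall i, smooth_sect (X i)) -> forall x,
    w x (fun i => X i x) = z x (fun i => X i x)) -> w = z.
Proof.
move=> wz; apply: functional_extensionality_dep => x; apply/funext => v.
have -> : v = fun i => ext (v i) x by apply/funext => i; rewrite extE.
by apply: (wz (fun i => ext (v i))) => i; exact: smooth_ext.
Qed.

End Bundle.

(** * The dual bundle *)

Section DualBundle.
Context {R : realType} {m : nat} {M : manifold R m} {r : nat} (E : vbundle M r).

Definition dual_frame_tuple (j : frame_index E) (x : M) : r.-tuple (covector (E x)) :=
  [tuple dual_frame j x a | a < r].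

Lemma dual_frame_coord (j : frame_index E) x (b : covector (E x)) : frame_dom j x ->
  b = \sum_a (b (tnth (frame j x) a) : R) *: dual_frame j x a.
Proof.
move=> dx; apply/lfunP => v; rewrite sum_lfunE {1}(frame_coord v dx) linear_sum.
apply: eq_bigr => a _.
by rewrite linearZ /= scale_lfunE lfunE /= [LHS]mulrC.
Qed.

Lemma dual_frame_frame (j : frame_index E) x a b : frame_dom j x ->
  dual_frame j x a (tnth (frame j x) b) = (b == a)%:R.
Proof. by move=> dx; rewrite lfunE /= coord_frame. Qed.

Lemma dual_frame_basis (j : frame_index E) x : frame_dom j x ->
  basis_of {:covector (E x)} (dual_frame_tuple j x).
Proof.
move=> dx; apply/andP; split; last first.
  apply/freeP => k k0 i.
  have {}k0 : \sum_a k a *: dual_frame j x a = 0.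
    by rewrite -[RHS]k0; apply: eq_bigr => a _; rewrite -tnth_nth tnth_mktuple.
  have /lfunP/(_ (tnth (frame j x) i)) := k0.
  rewrite sum_lfunE lfunE /= (bigD1 i) //= big1 => [|a ai].
    rewrite scale_lfunE dual_frame_frame // eqxx addr0 => <-.
    by rewrite [RHS]mulr1.
  by rewrite scale_lfunE dual_frame_frame // eq_sym (negbTE ai) [LHS]mulr0.
rewrite eqEsubv subvf; apply/subvP => b _.
rewrite (dual_frame_coord b dx); apply: memv_suml => a _.
apply: memvZ; apply: memv_span; apply/tnthP; exists a.
by rewrite tnth_mktuple.
Qed.

Lemma dual_tuple_coord (j : frame_index E) x (b : covector (E x)) a : frame_dom j x ->
  coord (dual_frame_tuple j x) a b = b (tnth (frame j x) a).
Proof.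
move=> dx; rewrite {1}(dual_frame_coord b dx).
rewrite (eq_bigr (fun i => (b (tnth (frame j x) i) : R) *: (dual_frame_tuple j x)`_i)) => [|i _].
  rewrite (coord_sum_free (fun i => b (tnth (frame j x) i))) //.
  exact: basis_free (dual_frame_basis dx).
by rewrite -tnth_nth tnth_mktuple.
Qed.

(** Dual frames change by the transpose of the transition matrix taken in the opposite direction. *)
Lemma dual_frame_transition (j j' : frame_index E) (a b : 'I_r) :
    smooth_on (frame_dom j `&` frame_dom j')
      (fun x => coord (dual_frame_tuple j' x) a (tnth (dual_frame_tuple j x) b)).
Proof.
apply: (@smooth_on_eq _ _ _ _ (fun x => coord (frame j x) b (tnth (frame j' x) a))).
- by apply: openI; exact: frame_dom_open.
- by move=> x [dx dx']; rewrite dual_tuple_coord // tnth_mktuple lfunE.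
- by rewrite setIC; exact: frame_transition.
Qed.

(** Its k-forms are, up to conversion, the multisections of E, so every result on forms applies to
    them. *)
Definition dual_bundle : vbundle M r :=
  @VBundle R m M r (fun x => covector (E x)) (frame_index E) (@frame_dom _ _ _ _ E)
    dual_frame_tuple (@frame_dom_open _ _ _ _ E) (@frame_cover _ _ _ _ E)
    dual_frame_basis dual_frame_transition.

Lemma smooth_dual_sectE (b : dual_sect E) :
  smooth_dual_sect b <-> @smooth_sect _ _ _ _ dual_bundle b.
Proof.
split=> sb j a; have oj := @frame_dom_open _ _ _ _ E j.
  by apply: (smooth_on_eq oj _ (sb j a)) => x dx; rewrite [RHS]dual_tuple_coord.
by apply: (smooth_on_eq oj _ (sb j a)) => x dx; rewrite [LHS]dual_tuple_coord.
Qed.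

Lemma smooth_multisectE k (P : multisect E k) :
  smooth_multisect P <-> @smooth_form _ _ _ _ dual_bundle k P.
Proof.
split=> -[Palt sP]; split=> // j I; have := sP j I; congr smooth_on;
  apply/funext => x; congr (P x); apply/funext => a; by rewrite tnth_mktuple.
Qed.

End DualBundle.

(** * Derivations of a vector bundle *)

Lemma dfwith_dfwith (k : nat) (T : Type) (w : 'I_k -> T) i u v :
  dfwith (dfwith w i u) i v = dfwith w i v.
Proof.
apply/funext => a; have [<-|ia] := eqVneq i a; first by rewrite !dfwithin.
by rewrite !dfwithout.
Qed.

Lemma dfwithC (k : nat) (T : Type) (w : 'I_k -> T) i j u v : i != j ->
  dfwith (dfwith w i u) j v = dfwith (dfwith w j v) i u.
Proof.
move=> ij; apply/funext => a; have [<-|ia] := eqVneq i a.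
  by rewrite dfwithin dfwithout ?dfwithin // eq_sym.
rewrite [RHS]dfwithout //; have [<-|ja] := eqVneq j a; first by rewrite !dfwithin.
by rewrite !dfwithout.
Qed.

Section Altmap.
Context {R : realType} {k : nat} {V : lmodType R} (f : ('I_k -> V) -> R).

Lemma multilinearZ w i a u : multilinear f -> f (dfwith w i (a *: u)) = a * f (dfwith w i u).
Proof.
move=> fl; have f0 : f (dfwith w i 0) = 0.
  by have := fl w i (-1) 0 0; rewrite scaler0 addr0 mulN1r addNr.
by rewrite -[a *: u]addr0 fl f0 addr0.
Qed.

Lemma multilinearD w i u v : multilinear f ->
  f (dfwith w i (u + v)) = f (dfwith w i u) + f (dfwith w i v).
Proof. by move=> fl; rewrite -[u in LHS]scale1r fl mul1r. Qed.

Lemma multilinearN w i u : multilinear f -> f (dfwith w i (- u)) = - f (dfwith w i u).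
Proof. by move=> fl; rewrite -scaleN1r multilinearZ // mulN1r. Qed.

Lemma multilinear_sumr w i (n : nat) (c : 'I_n -> R) (u : 'I_n -> V) : multilinear f ->
  f (dfwith w i (\sum_a c a *: u a)) = \sum_a c a * f (dfwith w i (u a)).
Proof.
move=> fl; elim/big_rec2: _ => [|a y1 y2 _ <-]; last by rewrite fl.
by rewrite -[0 in LHS](scale0r 0) multilinearZ // mul0r.
Qed.

(** The two tuples differ by the transposition of i and j. *)
Lemma altmap_swap w i j u : altmap f -> i != j -> w i = w j ->
  f (dfwith w i u) + f (dfwith w j u) = 0.
Proof.
move=> fa ij wij; rewrite -[X in _ + f X](_ : dfwith w i u \o tperm i j = _).
  by rewrite alternating_tperm // subrr.
apply/funext => a /=; case: tpermP => [->|->|/eqP ai /eqP aj].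
- by rewrite !dfwithout // eq_sym.
- by rewrite !dfwithin.
- by rewrite !dfwithout // eq_sym.
Qed.

End Altmap.

Section Derivations.
Context {R : realType} {m : nat} {M : manifold R m} {r : nat}.

(** A covariant differential operator: [dl] differentiates sections over the derivation [D] of
    functions, its symbol. *)
Record derivation (E : vbundle M r) (D : (M -> R) -> M -> R) (dl : sect E -> sect E)
    : Prop := Derivation {
  der_smooth : forall f, smooth f -> smooth (D f);
  der_lin : forall (a : R) f g, smooth f -> smooth g -> forall x,
    D (fun y => a * f y + g y) x = a * D f x + D g x;
  derM : forall f g, smooth f -> smooth g -> forall x,
    D (fun y => f y * g y) x = f x * D g x + g x * D f x;
  der_sect_smooth : forall X, smooth_sect X -> smooth_sect (dl X);
  der_sect_lin : forall f X Y, smooth f -> smooth_sect X -> smooth_sect Y ->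
    dl (fun x => f x *: X x + Y x) =
    (fun x => f x *: dl X x + (D f x *: X x + dl Y x)) }.

(* With [D] the action of a section X of a Lie algebroid, this is the Lie
   derivative of forms for [dl = bracket X], and the Schouten bracket with X for
   [dl = lie_dual X] on the dual bundle. *)
Definition lie (E : vbundle M r) (D : (M -> R) -> M -> R) (dl : sect E -> sect E)
    (k : nat) (w : kform E k) (X : 'I_k -> sect E) : M -> R :=
  fun x => D (fun y => w y (fun i => X i y)) x
           - \sum_(i < k) w x (dfwith (fun c => X c x) i (dl (X i) x)).

Section Derivation.
Context {E : vbundle M r} {D : (M -> R) -> M -> R} {dl : sect E -> sect E}.
Hypothesis der : derivation D dl.

Lemma der_cst0 x : D (fun=> 0) x = 0.
Proof.
have := der_lin der (-1) (smooth_cst 0) (smooth_cst 0) x.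
by rewrite mulr0 addr0 mulN1r addNr.
Qed.

Lemma derD f g x : smooth f -> smooth g -> D (fun y => f y + g y) x = D f x + D g x.
Proof.
move=> sf sg; rewrite -[D f x]mul1r -(der_lin der) //; congr (D _ x).
by apply/funext => y; rewrite mul1r.
Qed.

Lemma derZ (a : R) f x : smooth f -> D (fun y => a * f y) x = a * D f x.
Proof.
move=> sf; rewrite -[RHS]addr0 -(der_cst0 x) -(der_lin der) //; last exact: smooth_cst.
by congr (D _ x); apply/funext => y; rewrite addr0.
Qed.

Lemma der_cst (c : R) x : D (fun=> c) x = 0.
Proof.
have D1 : D (fun=> 1) x = 0.
  have := derM der (smooth_cst 1) (smooth_cst 1) x; rewrite mulr1 !mul1r => /eqP.
  by rewrite -subr_eq0 opprD addrA subrr sub0r oppr_eq0 => /eqP.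
have := derZ c x (smooth_cst 1); rewrite D1 mulr0 => <-.
by congr (D _ x); apply/funext => y; rewrite mulr1.
Qed.

Lemma derN f x : smooth f -> D (fun y => - f y) x = - D f x.
Proof.
move=> sf; rewrite -mulN1r -derZ //; congr (D _ x).
by apply/funext => y; rewrite mulN1r.
Qed.

Lemma derB f g x : smooth f -> smooth g -> D (fun y => f y - g y) x = D f x - D g x.
Proof. by move=> sf sg; rewrite derD ?derN //; exact: smoothN. Qed.

Lemma der_sum (I : Type) (s : seq I) (f : I -> M -> R) x : (forall i, smooth (f i)) ->
  D (fun y => \sum_(i <- s) f i y) x = \sum_(i <- s) D (f i) x.
Proof.
move=> sf; elim: s => [|i s IH].
  rewrite big_nil -[RHS](der_cst0 x); congr (D _ x).
  by apply/funext => y; rewrite big_nil.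
rewrite big_cons -IH -derD //; last exact: smooth_sum.
by congr (D _ x); apply/funext => y; rewrite big_cons.
Qed.

(** With a bump function phi, phi f = phi g everywhere. The Leibniz rule at x then gives the claim,
    because phi x = 1 and the terms in D phi agree by f x = g x. *)
Lemma der_local f g x : smooth f -> smooth g -> (\forall y \near x, f y = g y) ->
  D f x = D g x.
Proof.
move=> sf sg; rewrite /prop_near1 nbhsE => -[W [oW Wx] fg].
have [phi [C [sphi phi1 _ CW phi0]]] := exists_bump oW Wx.
have phix := nbhs_singleton phi1.
suff : D (fun y => phi y * f y) x = D (fun y => phi y * g y) x.
  rewrite !(derM der) // (fg x Wx) phix !mul1r => /eqP.
  by rewrite (inj_eq (addIr _)) => /eqP.
congr (D _ x); apply/funext => y; have [Cy|nC] := pselect (C y).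
  by rewrite fg //; exact: CW.
by rewrite phi0 // !mul0r.
Qed.

(** The term in D f from differentiating the value of w cancels the one from [dl] in slot i. For
    alternation, the summands i and j cancel by [altmap_swap], and every other summand still has two
    equal entries. *)
Lemma lie_tensorial (k : nat) (w : kform E k) : smooth_form w ->
  tensorial (lie D dl w).
Proof.
move=> sw; have wml x := (sw.1 x).1.
have sdl Y : smooth_sect Y -> smooth_sect (dl Y) by exact: (der_sect_smooth der).
have sw1 (X : 'I_k -> sect E) i Y : (forall i, smooth_sect (X i)) -> smooth_sect Y ->
    smooth (fun x => w x (dfwith (fun c => X c x) i (Y x))).
  move=> sX sY; have := smooth_form_eval sw (dfwith_P i sX sY).
  by congr smooth; apply/funext => y; rewrite (dfwith_fun (fun Z : sect E => Z y)).
split=> [X sX|X i f Y Z sX sf sY sZ x|X i j sX ij Xij x].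
- apply: smoothD; first by apply: (der_smooth der); exact: smooth_form_eval.
  by apply: smoothN; apply: smooth_sum => i; apply: sw1 => //; exact: sdl.
- rewrite /lie.
  have evD U y : w y (fun a => dfwith X i U a y) = w y (dfwith (fun a => X a y) i (U y)).
    by rewrite (dfwith_fun (fun Z : sect E => Z y)).
  have evS U a : w x (dfwith (fun c => dfwith X i U c x) a (dl (dfwith X i U a) x)) =
      if a == i then w x (dfwith (fun c => X c x) i (dl U x))
      else w x (dfwith (dfwith (fun c => X c x) a (dl (X a) x)) i (U x)).
    rewrite (dfwith_fun (fun Z : sect E => Z x)); have [->|ai] := eqVneq a i.
      by rewrite dfwithin dfwith_dfwith.
    by rewrite dfwithout 1?eq_sym // dfwithC 1?eq_sym.
  have -> : (fun y => w y (fun a => dfwith X i (fun y => f y *: Y y + Z y) a y)) =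
    (fun y => f y * w y (fun a => dfwith X i Y a y) + w y (fun a => dfwith X i Z a y)).
    by apply/funext => y; rewrite !evD wml.
  have sE U : smooth_sect U -> smooth (fun y => w y (fun a => dfwith X i U a y)).
    by move=> sU; apply: smooth_form_eval => //; exact: dfwith_P.
  rewrite derD ?(derM der); try exact: sE; [|done|by apply: smoothM => //; exact: sE].
  rewrite !(eq_bigr _ (fun a _ => evS _ a)).
  rewrite (bigD1 i) //= [X in _ = _ * (_ - X) + _](bigD1 i) //= [X in _ = _ + (_ - X)](bigD1 i) //= !eqxx.
  rewrite (der_sect_lin der) // wml multilinearD // multilinearZ // !evD.
  set S1 := \sum_(a | _) _; set S2 := \sum_(a | _) _; set S3 := \sum_(a | _) _.
  have -> : S1 = f x * S2 + S3.
    rewrite /S1 /S2 /S3 mulr_sumr -big_split /=; apply: eq_bigr => a ai.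
    by rewrite (negbTE ai) wml.
  ring.
- have w0 y : w y (fun a => X a y) = 0.
    by apply: (sw.1 y).2 ij _; rewrite Xij.
  rewrite /lie (_ : (fun y => w y _) = fun=> 0); last exact/funext.
  rewrite der_cst0 sub0r (bigD1 i) //= (bigD1 j) /=; last by rewrite eq_sym.
  rewrite addrA -Xij altmap_swap //; [|exact: (sw.1 x)|by rewrite Xij].
  rewrite add0r big1 ?oppr0 // => a /andP[ai aj].
  apply: (sw.1 x).2 ij _.
  by rewrite !dfwithout ?Xij.
Qed.

End Derivation.

(** In the expansion of a double Lie derivative, the single sums in which one operator acts on the
    value of w and the other on an argument are symmetric in the two operators, so they drop out of
    the commutator. The forms [w1] and [w2] stand for the first Lie derivatives, since [lie] acts on
    forms. *)
Lemma lie_commutator (E : vbundle M r) D D1 D2 (dl d1 d2 : sect E -> sect E)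
    (k : nat) (w w1 w2 : kform E k) (X : 'I_k -> sect E) x :
  derivation D dl -> derivation D1 d1 -> derivation D2 d2 ->
  (forall f, smooth f -> forall x, D f x = D1 (D2 f) x - D2 (D1 f) x) ->
  (forall Y, smooth_sect Y -> forall x, dl Y x = d1 (d2 Y) x - d2 (d1 Y) x) ->
  smooth_form w ->
  (forall X, (forall i, smooth_sect (X i)) -> forall x,
     w1 x (fun i => X i x) = lie D1 d1 w X x) ->
  (forall X, (forall i, smooth_sect (X i)) -> forall x,
     w2 x (fun i => X i x) = lie D2 d2 w X x) ->
  (forall i, smooth_sect (X i)) ->
  lie D dl w X x = lie D1 d1 w2 X x - lie D2 d2 w1 X x.
Proof.
move=> der der1 der2 DE dlE sw w1E w2E sX.
have expand Da Db (da db : sect E -> sect E) (wb : kform E k) :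
    derivation Da da -> derivation Db db ->
    (forall X, (forall i, smooth_sect (X i)) -> forall x,
      wb x (fun i => X i x) = lie Db db w X x) ->
    lie Da da wb X x = Da (Db (fun y => w y (fun i => X i y))) x
    - \sum_i Da (fun y => w y (fun c => dfwith X i (db (X i)) c y)) x
    - \sum_i Db (fun y => w y (fun c => dfwith X i (da (X i)) c y)) x
    + \sum_i \sum_j w x (fun c => dfwith (dfwith X i (da (X i))) j (db (dfwith X i (da (X i)) j)) c x).
  move=> dera derb wbE.
  have sdb i : smooth_sect (db (X i)) by exact: (der_sect_smooth derb).
  have sda i : smooth_sect (da (X i)) by exact: (der_sect_smooth dera).
  have sXb i : forall a, smooth_sect (dfwith X i (db (X i)) a) by exact: dfwith_P.
  have sXa i : forall a, smooth_sect (dfwith X i (da (X i)) a) by exact: dfwith_P.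
  rewrite /lie.
  have -> : (fun y => wb y (fun i => X i y)) = fun y =>
     Db (fun y => w y (fun i => X i y)) y - \sum_i w y (fun c => dfwith X i (db (X i)) c y).
    apply/funext => y; rewrite wbE // /lie; congr (_ - _); apply: eq_bigr => i _.
    by rewrite (dfwith_fun (fun Z : sect E => Z y)).
  rewrite (derB dera); last 2 first.
  - by apply: (der_smooth derb); exact: smooth_form_eval.
  - by apply: smooth_sum => i; exact: smooth_form_eval.
  rewrite (der_sum dera); last by move=> i; exact: smooth_form_eval.
  rewrite -!addrA; congr (_ + (_ + _)).
  rewrite -!sumrN -big_split; apply: eq_bigr => i _ /=.
  rewrite -(dfwith_fun (fun Z : sect E => Z x)) wbE // /lie.
  rewrite opprB addrC; congr (_ + _); apply: eq_bigr => j _.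
  by congr (w x _); apply: esym; exact: (dfwith_fun (fun Z : sect E => Z x)).
rewrite (expand _ _ _ _ _ der1 der2 w2E) (expand _ _ _ _ _ der2 der1 w1E).
set S12 := \sum_i _; set S21 := \sum_i _; set S1 := \sum_i _; set S2 := \sum_i _.
have -> : lie D dl w X x = D1 (D2 (fun y => w y (fun i => X i y))) x
   - D2 (D1 (fun y => w y (fun i => X i y))) x + (S12 - S21).
  rewrite /lie DE; last exact: smooth_form_eval.
  (* Off the diagonal, the (i, j) term of [S12] is the (j, i) term of [S21]. The diagonals contain
     d2 (d1 X_i) and d1 (d2 X_i), which combine to [dl]. *)
  congr (_ + _); rewrite -sumrN /S21 exchange_big -sumrB; apply: eq_bigr => i _.
  rewrite -sumrB (bigD1 i) //= big1 => [|j ji].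
    rewrite !dfwithin !dfwith_dfwith addr0.
    rewrite !(dfwith_fun (fun Z : sect E => Z x)) dlE // (multilinearD _ _ _ _ (sw.1 x).1).
    by rewrite (multilinearN _ _ _ (sw.1 x).1) opprB addrC.
  have -> : dfwith X i (d1 (X i)) j = X j by rewrite dfwithout // eq_sym.
  have -> : dfwith X j (d2 (X j)) i = X i by rewrite dfwithout.
  by rewrite [dfwith (dfwith X i _) _ _]dfwithC ?subrr // eq_sym.
ring.
Qed.

End Derivations.

(** * Contragredient derivations *)

Section DualDerivation.
Context {R : realType} {m : nat} {M : manifold R m} {r : nat} {E : vbundle M r}.
Implicit Types (b c : dual_sect E) (Y : sect E).

Lemma smooth_dual_sect_eval b Y : smooth_dual_sect b -> smooth_sect Y ->
  smooth (fun x => b x (Y x)).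
Proof.
move=> sb sY; apply: smooth_local => x; have [j dx] := frame_cover E x.
have oj := @frame_dom_open _ _ _ _ E j; exists (frame_dom j) => //.
apply: (@smooth_on_eq _ _ _ _ (fun y =>
  \sum_a coord (frame j y) a (Y y) * b y (tnth (frame j y) a))) => // [y dy|].
  by rewrite [in RHS](frame_coord (Y y) dy) linear_sum; apply: eq_bigr => a _; rewrite linearZ.
by apply: smooth_on_sum => // a; apply: smooth_onM.
Qed.

Lemma smooth_dual_sectP b :
  (forall Y, smooth_sect Y -> smooth (fun x => b x (Y x))) -> smooth_dual_sect b.
Proof.
move=> sb j a; apply: smooth_on_local => x dx.
have [phi [Y [_ sY nY _ _]]] := local_frame dx.
move: nY; rewrite /prop_near1 nbhsE => -[W [oW Wx] WY]; exists W => //.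
apply: (@smooth_on_eq _ _ _ _ (fun x => b x (Y a x))) => // [y Wy|].
  by have [_ ->] := WY y Wy.
by apply: smooth_onW; exact: sb.
Qed.

Lemma covector_ext x (b c : covector (E x)) :
  (forall Y, smooth_sect Y -> b (Y x) = c (Y x)) -> b = c.
Proof. by move=> bc; apply/lfunP => v; rewrite -(extE v); apply/bc/smooth_ext. Qed.

Lemma sect_ext x (u v : E x) : (forall b : covector (E x), b u = b v) -> u = v.
Proof.
move=> uv; have [j dx] := frame_cover E x.
rewrite (frame_coord u dx) (frame_coord v dx); apply: eq_bigr => a _; congr (_ *: _).
by have := uv (dual_frame j x a); rewrite !lfunE.
Qed.

(** [ds] is contragredient to [dl]. This is a predicate because the instance of interest,
    [lie_dual], comes with a definition of its own. *)
Definition dual_derivation (D : (M -> R) -> M -> R) (dl : sect E -> sect E)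
    (ds : dual_sect E -> dual_sect E) : Prop :=
  forall b Y, smooth_dual_sect b -> smooth_sect Y ->
  forall x, ds b x (Y x) = D (fun y => b y (Y y)) x - b x (dl Y x) :> R.

Lemma dual_derivationP D dl ds : derivation D dl -> dual_derivation D dl ds ->
  @derivation _ _ _ _ (dual_bundle E) D ds.
Proof.
move=> der dual; split; try by case: der.
- move=> b /smooth_dual_sectE sb; apply/smooth_dual_sectE/smooth_dual_sectP => Y sY.
  apply: (smooth_eq (f := fun x => D (fun y => b y (Y y)) x - b x (dl Y x))).
    by move=> x; rewrite dual.
  apply: smoothD; first by apply: (der_smooth der); exact: smooth_dual_sect_eval.
  apply: smoothN; apply: smooth_dual_sect_eval => //; exact: (der_sect_smooth der).
- move=> f b c sf /smooth_dual_sectE sb /smooth_dual_sectE sc.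
  have sl : smooth_dual_sect (fun x => f x *: b x + c x).
    apply/smooth_dual_sectP => Y sY.
    apply: (smooth_eq (f := fun x => f x * b x (Y x) + c x (Y x))).
      by move=> x; rewrite add_lfunE scale_lfunE.
    apply: smoothD; last exact: smooth_dual_sect_eval.
    by apply: smoothM => //; exact: smooth_dual_sect_eval.
  apply: functional_extensionality_dep => x; apply: covector_ext => Y sY.
  have sbY := smooth_dual_sect_eval sb sY; have scY := smooth_dual_sect_eval sc sY.
  rewrite !(add_lfunE, scale_lfunE) !dual //.
  have -> : (fun y => (f y *: b y + c y) (Y y)) = (fun y => f y * b y (Y y) + c y (Y y)).
    by apply/funext => y; rewrite add_lfunE scale_lfunE.
  rewrite (derD der) //; last exact: smoothM.
  rewrite (derM der) // !(add_lfunE, scale_lfunE) /GRing.scale /=.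
  ring.
Qed.

(** Evaluated on Y, the mixed terms D1 (b (d2 Y)) and D2 (b (d1 Y)) occur in both compositions and
    cancel. *)
Lemma dual_commutator D D1 D2 (dl d1 d2 : sect E -> sect E) ds ds1 ds2 :
  derivation D dl -> derivation D1 d1 -> derivation D2 d2 ->
  dual_derivation D dl ds -> dual_derivation D1 d1 ds1 -> dual_derivation D2 d2 ds2 ->
  (forall f, smooth f -> forall x, D f x = D1 (D2 f) x - D2 (D1 f) x) ->
  (forall Y, smooth_sect Y -> forall x, dl Y x = d1 (d2 Y) x - d2 (d1 Y) x) ->
  forall b, smooth_dual_sect b -> forall x, ds b x = ds1 (ds2 b) x - ds2 (ds1 b) x.
Proof.
move=> der der1 der2 du du1 du2 DE dlE b sb x.
have sds1 c : smooth_dual_sect c -> smooth_dual_sect (ds1 c).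
  by rewrite !smooth_dual_sectE; exact: (der_sect_smooth (dual_derivationP der1 du1)).
have sds2 c : smooth_dual_sect c -> smooth_dual_sect (ds2 c).
  by rewrite !smooth_dual_sectE; exact: (der_sect_smooth (dual_derivationP der2 du2)).
have [sd1 sd2] := (der_sect_smooth der1, der_sect_smooth der2).
have sbe := smooth_dual_sect_eval sb.
apply: covector_ext => Y sY.
rewrite add_lfunE opp_lfunE du // (du1 (ds2 b)) ?(du2 (ds1 b)) //; [|exact: sds1|exact: sds2].
rewrite (_ : (fun y => ds2 b y (Y y)) = fun y => D2 (fun z => b z (Y z)) y - b y (d2 Y y)); last first.
  by apply/funext => y; rewrite du2.
rewrite (_ : (fun y => ds1 b y (Y y)) = fun y => D1 (fun z => b z (Y z)) y - b y (d1 Y y)); last first.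
  by apply/funext => y; rewrite du1.
rewrite (derB der1); [|by apply: (der_smooth der2); exact: sbe|by apply/sbe/sd2].
rewrite (derB der2); [|by apply: (der_smooth der1); exact: sbe|by apply/sbe/sd1].
rewrite (du2 b (d1 Y)) ?(du1 b (d2 Y)) //; try by [exact: sd1|exact: sd2].
rewrite DE; last exact: sbe.
rewrite dlE // linearB /=.
ring.
Qed.

End DualDerivation.

(** * The differential of a Lie algebroid *)

Section Ocons.
Context {k : nat} {T : Type}.

Lemma ocons0 (t : T) (s : 'I_k -> T) : ocons t s ord0 = t.
Proof. by rewrite /ocons unlift_none. Qed.

Lemma ocons_lift (t : T) (s : 'I_k -> T) i : ocons t s (lift ord0 i) = s i.
Proof. by rewrite /ocons liftK. Qed.

Lemma ocons_eta (s : 'I_k.+1 -> T) : ocons (s ord0) (fun i => s (lift ord0 i)) = s.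
Proof.
by apply/funext => i; case: (unliftP ord0 i) => [a ->|->]; rewrite ?ocons_lift ?ocons0.
Qed.

Lemma ocons_P (P : T -> Prop) t (s : 'I_k -> T) :
  P t -> (forall i, P (s i)) -> forall i, P (ocons t s i).
Proof.
by move=> Pt Ps i; case: (unliftP ord0 i) => [a ->|->]; rewrite ?ocons_lift ?ocons0.
Qed.

End Ocons.

Lemma ocons_fun (k : nat) (T S : Type) (g : T -> S) t (s : 'I_k -> T) :
  (fun i => g (ocons t s i)) = ocons (g t) (fun i => g (s i)).
Proof.
by apply/funext => i; case: (unliftP ord0 i) => [a ->|->]; rewrite ?ocons_lift ?ocons0.
Qed.

Lemma lift_lift0 (k : nat) (i : 'I_k.+1) : lift (lift ord0 i) ord0 = ord0.
Proof. exact: val_inj. Qed.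

Lemma lift_lift (k : nat) (i : 'I_k.+1) (a : 'I_k) :
  lift (lift ord0 i) (lift ord0 a) = lift ord0 (lift i a).
Proof. by apply: val_inj; rewrite /= /bump /= !add1n ltnS addnS. Qed.

Section Algebroid.
Context {R : realType} {m : nat} {M : manifold R m} {r : nat} {A : lie_algebroid M r}.
Implicit Types X Y : sect A.

(** The axioms give additivity in the first argument of the bracket and the Leibniz rule in the
    second; antisymmetry transports the former. *)
Lemma ad_derivation X : smooth_sect X ->
  @derivation _ _ _ _ A (anchor_act X) (bracket X).
Proof.
move=> sX; split.
- by move=> f sf; exact: anchor_smooth.
- by move=> a f g sf sg x; rewrite /anchor_act anchor_linear_fun.
- by move=> f g sf sg x; rewrite /anchor_act anchor_leibniz.
- by move=> Y sY; exact: bracket_smooth.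
- move=> f Y Z sf sY sZ; have sfY := smooth_sectZ sf sY.
  rewrite bracket_anti //; last exact: smooth_sect_lin.
  have -> : (fun x => f x *: Y x + Z x) = (fun x => 1 *: (f x *: Y x) + Z x).
    by apply: functional_extensionality_dep => x; rewrite scale1r.
  rewrite bracket_linear //; apply: functional_extensionality_dep => x.
  rewrite scale1r opprD addrA; congr (_ + _).
    have /(congr1 (fun Z : sect A => Z x)) := bracket_anti sX sfY => <-.
    by rewrite bracket_leibniz.
  by have /(congr1 (fun Z : sect A => Z x)) := bracket_anti sX sZ => <-.
Qed.

Lemma interiorE (k : nat) X (w : kform A k.+1) x v :
  interior_product X w x v = w x (ocons (X x) v).
Proof. by []. Qed.

Lemma interior_smooth (k : nat) X (w : kform A k.+1) :
  smooth_form w -> smooth_sect X -> smooth_form (interior_product X w).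
Proof.
move=> sw sX; apply: smooth_formP => [x|Y sY].
  split=> [v i a u u'|v i j ij vij]; rewrite !interiorE.
    by rewrite !ocons_dfwith; exact: (sw.1 x).1.
  by apply: ((sw.1 x).2 _ (lift ord0 i) (lift ord0 j)); rewrite ?(inj_eq lift_inj) ?ocons_lift.
have := smooth_form_eval sw (ocons_P (P := @smooth_sect _ _ _ _ A) sX sY).
congr smooth; apply/funext => x; rewrite interiorE.
by rewrite (ocons_fun (fun Z : sect A => Z x)).
Qed.

(** The terms with i = 0 form the Lie derivative along X_0. In the others X_0 stays in front, and
    the shift of i by one reverses the sign. *)
Lemma koszul_cartan (k : nat) (w : kform A k.+1) (X : 'I_k.+2 -> sect A) x :
  koszul w X x =
  lie (anchor_act (X ord0)) (bracket (X ord0)) w (fun i => X (lift ord0 i)) x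
  - koszul (interior_product (X ord0) w) (fun i => X (lift ord0 i)) x.
Proof.
rewrite /koszul /lie big_ord_recl [X in _ - X]big_ord_recl !expr0 mul1r.
set t0 := anchor_act _ _ _.
set u0 := (X in (_ + _) - (X + _)); set S1 := (X in (_ + X) - _); set S2 := (X in _ - (_ + X) = _).
set L := (X in _ = _ - X - _); set S1' := (X in _ = _ - (X - _)); set S2' := (X in _ = _ - (_ - X)).
have -> : S1 = - S1'.
  rewrite /S1 /S1' -sumrN; apply: eq_bigr => i _.
  rewrite lift0 exprS -mulrA mulN1r; congr (- (_ * anchor_act _ _ _)).
  apply/funext => y; rewrite interiorE; congr (w y).
  apply/funext => a; case: (unliftP ord0 a) => [b ->|->].
    by rewrite lift_lift ocons_lift.
  by rewrite lift_lift0 ocons0.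
have -> : u0 = L.
  by rewrite /u0 /L; apply: eq_big => // a _; rewrite mul1r.
(* For i > 0 the slot a = 0 holds X_0 and is excluded by the condition i < lift i a, so the inner
   sums match after the shift. *)
have -> : S2 = - S2'.
  rewrite /S2 /S2' -sumrN; apply: eq_bigr => i _.
  rewrite big_mkcond big_ord_recl lift_lift0 [LHS]add0r [X in _ = - X]big_mkcond -sumrN.
  apply: eq_bigr => a _; rewrite !lift_lift !lift0 ltnS; case: ifP => _; last by rewrite oppr0.
  rewrite exprS -mulrA mulN1r interiorE ocons_dfwith; congr (- (_ * w x (dfwith _ _ _))).
  apply/funext => c; case: (unliftP ord0 c) => [b ->|->].
    by rewrite lift_lift ocons_lift.
  by rewrite lift_lift0 ocons0.
by ring.
Qed.

Lemma koszul0 (w : kform A 0) (X : 'I_1 -> sect A) x :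
  koszul w X x = anchor_act (X ord0) (fun y => w y (fun a => X (lift ord0 a) y)) x.
Proof.
rewrite /koszul big_ord1 expr0 mul1r big1 ?subr0 // => i _.
by apply: big1 => -[].
Qed.

Lemma koszulN (k : nat) (w : kform A k) (X : 'I_k.+1 -> sect A) x :
  smooth_form w -> (forall i, smooth_sect (X i)) ->
  koszul (fun y v => - w y v) X x = - koszul w X x.
Proof.
move=> sw sX; rewrite /koszul opprB [RHS]addrC -!sumrN; congr (_ + _); apply: eq_bigr => i _.
  rewrite [anchor_act _ _ _](derN (ad_derivation (sX i))) ?mulrN //.
  by apply: smooth_form_eval => // a; exact: sX.
by rewrite -sumrN; apply: eq_bigr => a _; rewrite mulrN opprK.
Qed.

Lemma lie_ocons (k : nat) (D : (M -> R) -> M -> R) (dl : sect A -> sect A)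
    (w : kform A k.+1) Y0 (Y : 'I_k -> sect A) x :
  lie D dl w (ocons Y0 Y) x =
  D (fun y => w y (ocons (Y0 y) (fun i => Y i y))) x
  - w x (ocons (dl Y0 x) (fun i => Y i x))
  - \sum_i w x (ocons (Y0 x) (dfwith (fun c => Y c x) i (dl (Y i) x))).
Proof.
rewrite /lie big_ord_recl opprD addrA ocons0; congr (_ - _ - _).
- by congr (D _ x); apply/funext => y; rewrite (ocons_fun (fun Z : sect A => Z y)).
- by rewrite (ocons_fun (fun Z : sect A => Z x)) ocons_dfwith0.
- apply: eq_bigr => i _; rewrite ocons_lift (ocons_fun (fun Z : sect A => Z x)).
  by rewrite ocons_dfwith.
Qed.

Lemma koszul_ocons (k : nat) (w : kform A k.+1) X0 (X : 'I_k.+1 -> sect A) x :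
  koszul w (ocons X0 X) x =
  lie (anchor_act X0) (bracket X0) w X x - koszul (interior_product X0 w) X x.
Proof.
rewrite koszul_cartan ocons0 (_ : (fun i => ocons X0 X (lift ord0 i)) = X) //.
by apply/funext => i; rewrite ocons_lift.
Qed.

(** Splitting off X_0 hides the dependence on X_0, which differentiates there; exchanging it with
    X_1 moves it to a slot within reach of the induction. The reason is to split off both sections:
    what remains is antisymmetric, as the bracket is and as two interior products anticommute. *)
Lemma koszul_swap (k : nat) (w : kform A k.+1) X0 X1 (Y : 'I_k -> sect A) x :
  smooth_form w -> smooth_sect X0 -> smooth_sect X1 -> (forall i, smooth_sect (Y i)) ->
  koszul w (ocons X0 (ocons X1 Y)) x = - koszul w (ocons X1 (ocons X0 Y)) x.
Proof.
move=> sw s0 s1 sY; rewrite !koszul_ocons !lie_ocons.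
have -> : w x (ocons (bracket X0 X1 x) (fun i => Y i x)) =
    - w x (ocons (bracket X1 X0 x) (fun i => Y i x)).
  rewrite bracket_anti // -(ocons_dfwith0 0) multilinearN; last exact: (sw.1 x).1.
  by rewrite ocons_dfwith0.
(* For a 1-form the interior product is a function, and its Koszul sum is the anchor term alone;
   only in higher degree can a second section be split off. *)
case: k w Y sw sY => [|k] w Y sw sY.
  rewrite !big_ord0 !koszul0 !ocons0.
  have e X Y0 : (fun y => interior_product X w y (fun a => ocons Y0 Y (lift ord0 a) y))
     = (fun y => w y (ocons (X y) (fun i => Y i y))).
    by apply/funext => y; rewrite interiorE; congr (w y (ocons _ _)); apply/funext => -[].
  by rewrite !e; ring.
rewrite !koszul_ocons.
have -> : koszul (interior_product X1 (interior_product X0 w)) Y x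
   = - koszul (interior_product X0 (interior_product X1 w)) Y x.
  rewrite -koszulN //; last by do 2! apply: interior_smooth => //.
  congr (koszul _ Y x); apply: functional_extensionality_dep => y; apply/funext => v.
  rewrite !interiorE -(alternating_tperm _ (sw.1 y) (_ : ord0 != lift ord0 ord0)) //.
  congr (w y); apply/funext => a /=; case: tpermP => [->|->|].
  - by rewrite ocons0 ocons_lift ocons0.
  - by rewrite ocons0 ocons_lift ocons0.
  - case: (unliftP ord0 a) => [b ->|-> //]; rewrite !ocons_lift.
    by case: (unliftP ord0 b) => [c ->|-> //]; rewrite !ocons_lift.
have e X Z : lie (anchor_act X) (bracket X) (interior_product Z w) Y x =
    anchor_act X (fun y => w y (ocons (Z y) (fun i => Y i y))) x
    - \sum_i w x (ocons (Z x) (dfwith (fun c => Y c x) i (bracket X (Y i) x))) by [].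
by rewrite !e; ring.
Qed.

(** In the slots after the first one, the Lie derivative is tensorial as for any derivation, and the
    Koszul sum of the interior product is so by induction. *)
Lemma koszul_ocons_tensorial (k : nat) (w : kform A k.+1) X0 :
  (forall w : kform A k, smooth_form w -> tensorial (koszul w)) ->
  smooth_form w -> smooth_sect X0 -> tensorial (fun X : 'I_k.+1 -> sect A => koszul w (ocons X0 X)).
Proof.
move=> IH sw s0.
have -> : (fun X : 'I_k.+1 -> sect A => koszul w (ocons X0 X)) = (fun (X : 'I_k.+1 -> sect A) x =>
    lie (anchor_act X0) (bracket X0) w X x - koszul (interior_product X0 w) X x).
  by apply/funext => X; apply/funext => x; exact: koszul_ocons.
have [Ks Kl Ka] := IH _ (interior_smooth sw s0).
have [Ls Ll La] := lie_tensorial (ad_derivation s0) sw.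
split=> [X sX|X i f Y Z sX sf sY sZ x|X i j sX ij Xij x].
- by apply: smoothD; [exact: Ls|apply: smoothN; exact: Ks].
- by rewrite Ll // Kl //; ring.
- by rewrite (La _ i j) // (Ka _ i j) // subr0.
Qed.

Lemma koszul_tensorial (k : nat) (w : kform A k) : smooth_form w -> tensorial (koszul w).
Proof.
elim: k w => [|k IH] w sw.
  split=> [X sX|X i f Y Z sX sf sY sZ x|X i j _].
  - apply: (smooth_eq (f := anchor_act (X ord0) (fun y => w y (fun a => X (lift ord0 a) y)))).
      by move=> x; rewrite koszul0.
    by apply: anchor_smooth => //; exact: smooth_form_eval.
  - rewrite !koszul0 !ord1 !dfwithin /anchor_act.
    have e U : (fun y => w y (fun a : 'I_0 => dfwith X ord0 U (lift ord0 a) y)) =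
        (fun y => w y (fun a => X (lift ord0 a) y)).
      by apply/funext => y; congr (w y); apply/funext => -[].
    by rewrite !e anchor_linear //; exact: smooth_form_eval.
  - by rewrite !ord1 eqxx.
have T0 X0 := koszul_ocons_tensorial IH sw (X0 := X0).
split=> [X sX|X i f Y Z sX sf sY sZ x|X i j sX].
- by rewrite -(ocons_eta X); case: (T0 _ (sX ord0)) => + _ _; apply.
- case: (unliftP ord0 i) => [a ->|->].
    rewrite -(ocons_eta X) -!ocons_dfwith.
    by case: (T0 _ (sX ord0)) => _ + _; apply.
  (* Linearity in slot 0 becomes linearity in slot 1 by [koszul_swap]; the two signs cancel. *)
  pose X1 := X (lift ord0 ord0); pose X2 (a : 'I_k) := X (lift ord0 (lift ord0 a)).
  have e U : dfwith X ord0 U = ocons U (ocons X1 X2).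
    rewrite -(ocons_eta X) ocons_dfwith0; congr (ocons U _).
    by rewrite -(ocons_eta (fun _ => _)).
  have sl := smooth_sect_lin sf sY sZ.
  have sX2 a : smooth_sect (X2 a) by exact: sX.
  rewrite !e !(koszul_swap x sw _ (sX (lift ord0 ord0)) sX2) //.
  have [_ + _] := T0 X1 (sX _).
  have e' U : ocons U X2 = dfwith (ocons U X2) ord0 U by rewrite ocons_dfwith0.
  have e2 U V : ocons U X2 = dfwith (ocons V X2) ord0 U by rewrite ocons_dfwith0.
  rewrite (e2 _ Y) (e2 Z Y) {2}(e2 Y Y) => -> //; first by ring.
  by apply: ocons_P.
(* With slot 0 fixed the sum is an alternating form [eta], so the section equal to X'_0 can be
   transposed into slot 1; there [koszul_swap] makes the value its own opposite. *)
have alt0 (X' : 'I_k.+2 -> sect A) j' : (forall i, smooth_sect (X' i)) -> X' ord0 = X' (lift ord0 j') ->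
    forall x, koszul w X' x = 0.
  move=> sX' Xj x; have [eta [[ea _] etaE]] := tensorial_form (T0 _ (sX' ord0)).
  pose Y i := X' (lift ord0 i); have sY a : smooth_sect (Y a) by exact: sX'.
  have swap0 : koszul w (ocons (X' ord0) (Y \o tperm ord0 j')) x = 0.
    pose Z i := (Y \o tperm ord0 j') (lift ord0 i).
    have -> : Y \o tperm ord0 j' = ocons (X' ord0) Z.
      by rewrite -[LHS]ocons_eta /= tpermL Xj.
    have sZ a : smooth_sect (Z a) by exact: sX'.
    have := koszul_swap x sw (sX' ord0) (sX' ord0) sZ.
    by move/eqP; rewrite -subr_eq0 opprK -mulr2n mulrn_eq0 => /eqP.
  rewrite -(ocons_eta X') -etaE //.
  move: swap0; rewrite -etaE; last by move=> a; exact: sX'.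
  have [<-|j0] := eqVneq ord0 j'.
    by rewrite tperm1 => <-; congr (eta x); apply/funext => a /=; rewrite perm1.
  have := alternating_tperm (fun i => Y i x) (ea x) j0.
  by move=> -> /eqP; rewrite oppr_eq0 => /eqP.
case: (unliftP ord0 i) => [a ->|->]; case: (unliftP ord0 j) => [b ->|->] ij Xij x.
- rewrite -(ocons_eta X); case: (T0 _ (sX ord0)) => _ _ Ka.
  by apply: (Ka _ a b); rewrite // (inj_eq lift_inj) in ij.
- by apply: (alt0 _ a).
- by apply: (alt0 _ b).
- by rewrite eqxx in ij.
Qed.

(** [the] returns a witness as soon as one exists, so its default value is not reached for smooth
    w. *)
Lemma dA_spec (k : nat) (w : kform A k) : smooth_form w ->
  smooth_form (dA w) /\
  forall X : 'I_k.+1 -> sect A, (forall i, smooth_sect (X i)) ->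
      forall x, dA w x (fun i => X i x) = koszul w X x.
Proof.
move=> sw; rewrite /dA /the; case: pselect => [h|]; first by case: cid.
by case; exact: tensorial_form (koszul_tensorial sw).
Qed.

Lemma lie_formE (k : nat) (w : kform A k.+1) X0 (X : 'I_k.+1 -> sect A) x :
  smooth_form w -> smooth_sect X0 -> (forall i, smooth_sect (X i)) ->
  lie_form X0 w x (fun i => X i x) = lie (anchor_act X0) (bracket X0) w X x.
Proof.
move=> sw s0 sX; rewrite /lie_form interiorE.
rewrite -(ocons_fun (fun Z : sect A => Z x)) (dA_spec sw).2; last exact: ocons_P.
by rewrite (dA_spec (interior_smooth sw s0)).2 // koszul_ocons subrK.
Qed.

Lemma lie_form_smooth (k : nat) (w : kform A k.+1) X :
  smooth_form w -> smooth_sect X -> smooth_form (lie_form X w).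
Proof.
move=> sw sX; have [eta [seta etaE]] := tensorial_form (lie_tensorial (ad_derivation sX) sw).
rewrite (_ : lie_form X w = eta) //; apply: form_ext => Y sY x.
by rewrite lie_formE // etaE.
Qed.

Lemma lie_dual_derivation X : smooth_sect X ->
  dual_derivation (anchor_act X) (bracket X) (lie_dual X).
Proof.
move=> sX b Y sb sY x.
pose w : kform A 1 := fun y u => b y (u ord0).
have sw : smooth_form w.
  apply: smooth_formP => [y|Z sZ]; last exact: smooth_dual_sect_eval.
  split=> [v i a u u'|v i j]; last by rewrite !ord1 eqxx.
  by rewrite /w (ord1 i) !dfwithin linearP.
(* [lie_dual] is built with [linfun], which reproduces the given function only once that function is
   known to be linear. *)
have lin : linear (fun v : A x => lie_form X w x (fun _ => v) : R^o).
  move=> a u v; have wl := ((lie_form_smooth sw sX).1 x).1.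
  have e (t : A x) : (fun _ : 'I_1 => t) = dfwith (fun _ => 0) ord0 t.
    by apply/funext => i; rewrite (ord1 i) dfwithin.
  by rewrite (e (a *: u + v)) wl -!e.
pose G : {linear A x -> R^o} := HB.pack (fun v : A x => lie_form X w x (fun _ => v) : R^o)
   (GRing.isLinear.Build _ _ _ _ _ lin).
rewrite /lie_dual (lfunE G) /G /=.
apply: (etrans (lie_formE (X := fun=> Y) x sw sX (fun=> sY))); rewrite /lie big_ord1.
by congr (_ - _); rewrite /w dfwithin.
Qed.

Lemma schouten_spec (k : nat) (P : multisect A k) X :
  smooth_sect X -> smooth_multisect P ->
  smooth_multisect (schouten X P) /\
  forall b : 'I_k -> dual_sect A, (forall i, smooth_dual_sect (b i)) -> forall x,
    schouten X P x (fun i => b i x) =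
    @lie _ _ _ _ (dual_bundle A) (anchor_act X) (lie_dual X) k P b x.
Proof.
move=> sX sP; rewrite /schouten /the; case: pselect => [h|]; first by case: cid.
case.
have /smooth_multisectE sP' := sP.
have der := dual_derivationP (ad_derivation sX) (lie_dual_derivation sX).
have [Q [sQ QE]] := tensorial_form (lie_tensorial der sP').
exists Q; split; first exact/smooth_multisectE.
by move=> b sb x; apply: QE => i; apply/smooth_dual_sectE.
Qed.

End Algebroid.

(** * Contractions *)

Section ExtendBy.
Context {k l : nat}.

Lemma extend_by_fun (T S : Type) (g : T -> S) (s : 'I_k -> T) (t : 'I_l -> T) :
  (fun c => g (extend_by s t c)) = extend_by (fun a => g (s a)) (fun a => g (t a)).
Proof. by apply/funext => c; rewrite /extend_by; case: fintype.split. Qed.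

Lemma extend_by_P (T : Type) (P : T -> Prop) (s : 'I_k -> T) (t : 'I_l -> T) :
  (forall a, P (s a)) -> (forall a, P (t a)) -> forall c, P (extend_by s t c).
Proof. by move=> Ps Pt c; rewrite /extend_by; case: fintype.split. Qed.

Lemma extend_byR (T : Type) (s : 'I_k -> T) (t : 'I_l -> T) a :
  extend_by s t (cast_ord (addnC k l) (rshift k a)) = t a.
Proof.
rewrite /extend_by; case: splitP => b /= ab.
  by have := ltn_ord b; rewrite -ab ltnNge leq_addr.
by congr t; apply/val_inj/eqP; rewrite -(eqn_add2l k) ab.
Qed.

Lemma big_extend (R : nmodType) (F : 'I_(l + k) -> R) :
  \sum_c F c = \sum_a F (cast_ord (addnC k l) (lshift l a))
             + \sum_a F (cast_ord (addnC k l) (rshift k a)).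
Proof.
rewrite (reindex (cast_ord (addnC k l))) /= ?big_split_ord //.
by exists (cast_ord (addnC l k)) => i _; apply: val_inj.
Qed.

Lemma extend_by_dfwithR (T : Type) (s : 'I_k -> T) (t : 'I_l -> T) a u :
  extend_by s (dfwith t a u) =
  dfwith (extend_by s t) (cast_ord (addnC k l) (rshift k a)) u.
Proof.
apply/funext => c.
have -> : c = cast_ord (addnC k l) (cast_ord (addnC l k) c) by apply: val_inj.
case: (split_ordP (cast_ord (addnC l k) c)) => b ->.
  rewrite extend_byL dfwithout ?extend_byL //.
  by rewrite (inj_eq (@cast_ord_inj _ _ _)) eq_rlshift.
rewrite extend_byR; have [<-|ab] := eqVneq a b; first by rewrite !dfwithin.
rewrite !dfwithout ?extend_byR //.
by rewrite (inj_eq (@cast_ord_inj _ _ _)) (inj_eq (@rshift_inj _ _)).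
Qed.

End ExtendBy.

Section IndexUpdate.
Context {R : comNzRingType} {k n : nat}.
Implicit Type I : {ffun 'I_k -> 'I_n}.

Definition upd I (a : 'I_k) (j : 'I_n) : {ffun 'I_k -> 'I_n} :=
  [ffun c => dfwith I a j c].

Lemma updE I a j : upd I a j = dfwith I a j :> ('I_k -> 'I_n).
Proof. by apply/funext => c; rewrite ffunE. Qed.

Lemma upd_fun (T : Type) (u : 'I_n -> T) I a j :
  (fun c => u (upd I a j c)) = dfwith (fun c => u (I c)) a (u j).
Proof. by rewrite -(dfwith_fun u) updE. Qed.

(** The involution that exchanges I a with j: in slot a, a matrix moves from one factor of a full
    contraction to the other as its transpose. *)
Lemma sum_upd (g : 'I_n -> 'I_n -> R) (W Q : {ffun 'I_k -> 'I_n} -> R) a :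
  \sum_(I : {ffun 'I_k -> 'I_n}) \sum_j g (I a) j * W (upd I a j) * Q I =
  \sum_(I : {ffun 'I_k -> 'I_n}) \sum_j g j (I a) * W I * Q (upd I a j).
Proof.
rewrite !pair_big /= [RHS](reindex_inj (h := fun p => (upd p.1 a p.2, p.1 a))).
  apply: eq_bigr => -[I j] _ /=; rewrite updE dfwithin; congr (_ * _ * Q _).
  by apply/ffunP => c; rewrite !updE dfwith_dfwith dfwith_id.
apply: (can_inj (g := fun p => (upd p.1 a p.2, p.1 a))) => -[I j] /=.
rewrite updE dfwithin; congr pair.
by apply/ffunP => c; rewrite !updE dfwith_dfwith dfwith_id.
Qed.

End IndexUpdate.

Section Contraction.
Context {R : realType}.

Lemma covector_sum (V : vectType R) (n : nat) (u : 'I_n -> V) (th : 'I_n -> covector V)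
    (b : covector V) :
  (forall v, v = \sum_a (th a v : R) *: u a) -> b = \sum_a (b (u a) : R) *: th a.
Proof.
move=> uth; apply/lfunP => v; rewrite sum_lfunE {1}(uth v) linear_sum.
by apply: eq_bigr => a _; rewrite linearZ /= scale_lfunE [LHS]mulrC.
Qed.

(** [contract_form] uses a basis chosen in each fibre separately, which need not vary smoothly; here
    any u and th that resolve the identity may replace it. The coefficients that expand the basis in
    u inside w also expand th in the dual basis inside P. *)
Lemma contract_formE (k l n : nat) (V : vectType R) (w : ('I_k -> V) -> R)
    (P : ('I_(l + k) -> covector V) -> R) b (u : 'I_n -> V) (th : 'I_n -> covector V) :
  multilinear w -> altmap P -> (forall v, v = \sum_a (th a v : R) *: u a) ->
  contract_form w P b = (k`!%:R)^-1 * \sum_(I : {ffun 'I_k -> 'I_n})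
    w (fun a => u (I a)) * P (extend_by (fun a => th (I a)) b).
Proof.
move=> wml Pa uth; rewrite /contract_form; congr (_ * _).
have fml := (altmap_extend b Pa).1; set f := fun _ => _ in fml.
have wE (I : {ffun 'I_k -> 'I_(\dim {:V})}) : w (fun a => basis_vector (I a)) =
    \sum_(J : {ffun 'I_k -> 'I_n})
      (\prod_a (th (J a) (basis_vector (I a)) : R)) * w (fun a => u (J a)).
  rewrite -[RHS](multilinear_sum u (fun a j => th j (basis_vector (I a))) wml).
  by congr w; apply/funext => a; exact: uth.
under eq_bigr do rewrite wE mulr_suml.
rewrite exchange_big; apply: eq_bigr => J _ /=.
have -> : P (extend_by (fun a => th (J a)) b) = f (fun a => th (J a)) by [].
have -> : (fun a => th (J a)) = (fun a => \sum_i (th (J a) (basis_vector i) : R) *: dual_vector i).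
  by apply/funext => a; exact: dual_vectorE.
rewrite (multilinear_sum (@dual_vector R V) (fun a i => th (J a) (basis_vector i)) fml) mulr_sumr.
by apply: eq_bigr => I _; rewrite mulrCA mulrA.
Qed.

Context {m : nat} {M : manifold R m} {r : nat} {E : vbundle M r}.

(** [local_frame] is applied to E and to its dual over the same frame domain. *)
Lemma dual_frames (x : M) : exists (Y : 'I_r -> sect E) (th : 'I_r -> dual_sect E),
  [/\ forall a, smooth_sect (Y a), forall a, smooth_dual_sect (th a) &
    \forall y \near x, (forall v : E y, v = \sum_a (th a y v : R) *: Y a y) /\
       forall a b, th a y (Y b y) = (b == a)%:R].
Proof.
have [j dx] := frame_cover E x.
have [_ [Y [_ sY nY _ _]]] := local_frame dx.
have [_ [th [_ sth nth _ _]]] := local_frame (E := dual_bundle E) (j := j) dx.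
exists Y, th; split=> //; first by move=> a; apply/smooth_dual_sectE.
apply: filterS2 nY nth => y [dy Yy] [_ thy].
have thE a : th a y = dual_frame j y a by rewrite thy tnth_mktuple.
split=> [v|a b]; last by rewrite thE Yy dual_frame_frame.
by rewrite {1}(frame_coord v dy); apply: eq_bigr => a _; rewrite thE Yy lfunE.
Qed.

Lemma smooth_multisect_eval (n : nat) (Q : multisect E n) (c : 'I_n -> dual_sect E) :
  smooth_multisect Q -> (forall i, smooth_dual_sect (c i)) ->
  smooth (fun y => Q y (fun i => c i y)).
Proof.
move=> /smooth_multisectE sQ sc; apply: (smooth_form_eval sQ) => i.
exact/smooth_dual_sectE.
Qed.

Lemma smooth_contract (k l : nat) (w : kform E k) (P : multisect E (l + k))
    (b : 'I_l -> dual_sect E) :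
  smooth_form w -> smooth_multisect P -> (forall i, smooth_dual_sect (b i)) ->
  smooth (fun y => contract_form (w y) (P y) (fun i => b i y)).
Proof.
move=> sw sP sb; apply: smooth_local => x; have [Y [th [sY sth nYth]]] := dual_frames x.
move: nYth; rewrite /prop_near1 nbhsE => -[W [oW Wx] WY]; exists W => //.
apply: (@smooth_on_eq _ _ _ _ (fun y => (k`!%:R)^-1 * \sum_(I : {ffun 'I_k -> 'I_r})
    w y (fun a => Y (I a) y) * P y (fun c => extend_by (fun a => th (I a)) b c y))) => //.
  move=> y /WY[yE _]; rewrite (contract_formE _ (sw.1 y).1 (sP.1 y) yE).
  by under eq_bigr do rewrite (extend_by_fun (fun Z : dual_sect E => Z y)).
apply: smooth_onW; apply: smoothM; first exact: smooth_cst.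
apply: smooth_sum => I; apply: smoothM; first exact: smooth_form_eval.
by apply: smooth_multisect_eval => //; exact: extend_by_P.
Qed.

(* The terms in which the derivation acts on the dual frames cancel pairwise. *)
Lemma der_contract (k l : nat) (w : kform E k) (P : multisect E (l + k))
    (b : 'I_l -> dual_sect E)
    D dl ds (w1 : kform E k) (P1 : multisect E (l + k)) x :
  derivation D dl -> dual_derivation D dl ds ->
  smooth_form w -> smooth_multisect P -> (forall i, smooth_dual_sect (b i)) ->
  multilinear (w1 x) -> altmap (P1 x) ->
  (forall Y : 'I_k -> sect E, (forall i, smooth_sect (Y i)) ->
    w1 x (fun i => Y i x) = lie D dl w Y x) ->
  (forall c : 'I_(l + k) -> dual_sect E, (forall i, smooth_dual_sect (c i)) ->
    P1 x (fun i => c i x) = @lie _ _ _ _ (dual_bundle E) D ds _ P c x) ->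
  D (fun y => contract_form (w y) (P y) (fun i => b i y)) x =
  contract_form (w1 x) (P x) (fun i => b i x)
  + contract_form (w x) (P1 x) (fun i => b i x)
  + \sum_(i < l) contract_form (w x) (P x) (dfwith (fun c => b c x) i (ds (b i) x)).
Proof.
move=> der dual sw sP sb w1ml P1a w1E P1E.
have [Y [th [sY sth nYth]]] := dual_frames x.
have [xE xth] := nbhs_singleton nYth.
have Pa := sP.1 x; have wml := (sw.1 x).1.
pose Yx (I : {ffun 'I_k -> 'I_r}) a := Y (I a).
pose tx (I : {ffun 'I_k -> 'I_r}) : 'I_(l + k) -> dual_sect E := extend_by (fun a => th (I a)) b.
have stx I c : smooth_dual_sect (tx I c) by exact: extend_by_P.
have txE I y : (fun c => tx I c y) = extend_by (fun a => th (I a) y) (fun c => b c y).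
  by rewrite /tx (extend_by_fun (fun Z : dual_sect E => Z y)).
have swI I : smooth (fun y => w y (fun a => Yx I a y)).
  by apply: (smooth_form_eval (X := Yx I) sw) => a; exact: sY.
have sPI I : smooth (fun y => P y (fun c => tx I c y)).
  by apply: smooth_multisect_eval => // c; exact: stx.
rewrite (der_local der (g := fun y => (k`!%:R)^-1 * \sum_(I : {ffun 'I_k -> 'I_r})
   w y (fun a => Yx I a y) * P y (fun c => tx I c y))); last 3 first.
- exact: smooth_contract.
- apply: smoothM; first exact: smooth_cst.
  by apply: smooth_sum => I; exact: smoothM.
- apply: filterS nYth => y [yE _].
  rewrite (contract_formE _ (sw.1 y).1 (sP.1 y) yE); congr (_ * _).
  by apply: eq_bigr => I _; rewrite txE.
rewrite (derZ der); last by apply: smooth_sum => I; exact: smoothM.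
rewrite (der_sum der); last by move=> I; exact: smoothM.
rewrite !(contract_formE _ _ _ xE) //.
under [X in _ = _ + X]eq_bigr do rewrite (contract_formE _ wml Pa xE).
rewrite -mulr_sumr -!mulrDr; congr (_ * _).
rewrite exchange_big -!big_split /=.
pose g i j : R := th j x (dl (Y i) x).
pose W (I : {ffun 'I_k -> 'I_r}) := w x (fun a => Y (I a) x).
pose Q (I : {ffun 'I_k -> 'I_r}) := P x (extend_by (fun a => th (I a) x) (fun c => b c x)).
have dlE i : dl (Y i) x = \sum_j g i j *: Y j x by exact: xE.
(* The functions th_i (Y_j) are constant near x, so [D] kills them and the matrix of [ds] is minus
   the transpose of that of [dl]. *)
have dsE i : ds (th i) x = \sum_j (- g j i) *: th j x.
  rewrite (covector_sum (ds (th i) x) xE); apply: eq_bigr => j _; congr (_ *: _).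
  rewrite dual // (der_local der (g := fun=> (j == i)%:R)).
  - by rewrite (der_cst der) sub0r.
  - exact: smooth_dual_sect_eval.
  - exact: smooth_cst.
  - by apply: filterS nYth => y [_ ->].
have DwE I : D (fun y => w y (fun a => Yx I a y)) x =
    w1 x (fun a => Y (I a) x) + \sum_a \sum_j g (I a) j * W (upd I a j).
  rewrite (w1E (Yx I)) ?/lie; last by move=> a; exact: sY.
  rewrite -addrA -sumrN [X in _ = _ + X]addrC -big_split big1 ?addr0 // => a _ /=.
  rewrite dlE multilinear_sumr // -sumrN -big_split big1 // => j _ /=.
  by rewrite /W (upd_fun (fun i => Y i x)) addrC addNr.
have DPE I : D (fun y => P y (fun c => tx I c y)) x =
    P1 x (extend_by (fun a => th (I a) x) (fun c => b c x))
    - \sum_a \sum_j g j (I a) * Q (upd I a j)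
    + \sum_(i < l) P x (extend_by (fun a => th (I a) x) (dfwith (fun c => b c x) i (ds (b i) x))).
  rewrite -txE P1E ?/lie; last exact: stx.
  rewrite big_extend /=.
  have -> : \sum_a P x (dfwith (fun c => tx I c x) (cast_ord (addnC k l) (lshift l a))
        (ds (tx I (cast_ord (addnC k l) (lshift l a))) x)) =
      - \sum_a \sum_j g j (I a) * Q (upd I a j).
    rewrite -sumrN; apply: eq_bigr => a _.
    have -> : tx I (cast_ord (addnC k l) (lshift l a)) = th (I a) by exact: extend_byL.
    rewrite txE -extend_by_dfwith dsE.
    rewrite (multilinear_sumr _ _ _ _ (altmap_extend _ Pa).1) -sumrN.
    by apply: eq_bigr => j _; rewrite mulNr /Q (upd_fun (fun i => th i x)).
  have -> : \sum_a P x (dfwith (fun c => tx I c x) (cast_ord (addnC k l) (rshift k a))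
        (ds (tx I (cast_ord (addnC k l) (rshift k a))) x)) =
      \sum_(i < l) P x (extend_by (fun a => th (I a) x) (dfwith (fun c => b c x) i (ds (b i) x))).
    apply: eq_bigr => a _.
    have -> : tx I (cast_ord (addnC k l) (rshift k a)) = b a by exact: extend_byR.
    by rewrite txE -extend_by_dfwithR.
  ring.
(* The product rule gives the three expected terms and a remainder in g, whose sum over I is zero by
   [sum_upd]. *)
rewrite (eq_bigr (fun I : {ffun 'I_k -> 'I_r} =>
  (w1 x (fun a => Y (I a) x) * Q I
   + W I * P1 x (extend_by (fun a => th (I a) x) (fun c => b c x))
   + \sum_(i < l) W I *
       P x (extend_by (fun a => th (I a) x) (dfwith (fun c => b c x) i (ds (b i) x))))
  + (\sum_a \sum_j g (I a) j * W (upd I a j) * Q I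
     - \sum_a \sum_j g j (I a) * W I * Q (upd I a j)))).
  rewrite big_split /= sumrB [X in _ + (X - _)]exchange_big [X in _ + (_ - X)]exchange_big /=.
  rewrite -sumrB [X in _ + X]big1 ?addr0 // => a _.
  by rewrite sum_upd subrr.
move=> I _; rewrite (derM der) // DwE DPE txE -/(Q I).
have -> : \sum_a \sum_j g (I a) j * W (upd I a j) * Q I =
    Q I * \sum_a \sum_j g (I a) j * W (upd I a j).
  rewrite mulr_sumr; apply: eq_bigr => a _; rewrite mulr_sumr.
  by apply: eq_bigr => j _; rewrite [RHS]mulrC.
have -> : \sum_a \sum_j g j (I a) * W I * Q (upd I a j) =
    W I * \sum_a \sum_j g j (I a) * Q (upd I a j).
  rewrite mulr_sumr; apply: eq_bigr => a _; rewrite mulr_sumr.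
  by apply: eq_bigr => j _; rewrite mulrCA mulrA.
rewrite -mulr_sumr /W /Yx.
ring.
Qed.

End Contraction.

(** * Nambu structures *)

Section ContractForm.
Context {R : realType} {k l : nat} {V : vectType R}.
Implicit Types (w : ('I_k -> V) -> R) (P : ('I_(l + k) -> covector V) -> R).

Lemma contract_form_multilinear w P : altmap P -> multilinear (contract_form w P).
Proof.
move=> [Pml _] b i a u v; rewrite /contract_form mulrCA -mulrDr; congr (_ * _).
rewrite mulr_sumr -big_split; apply: eq_bigr => I _ /=.
by rewrite !extend_by_dfwithR Pml; ring.
Qed.

Lemma contract_formDl (a : R) w w' P b :
  contract_form (fun v => a * w v + w' v) P b =
  a * contract_form w P b + contract_form w' P b.
Proof.
rewrite /contract_form mulrCA -mulrDr; congr (_ * _).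
by rewrite mulr_sumr -big_split; apply: eq_bigr => I _ /=; ring.
Qed.

Lemma contract_formZr (a : R) w P b :
  contract_form w (fun c => a * P c) b = a * contract_form w P b.
Proof.
rewrite /contract_form mulrCA; congr (_ * _).
by rewrite mulr_sumr; apply: eq_bigr => I _; rewrite mulrCA.
Qed.

Lemma contract_form0r w P b : (forall c, P c = 0) -> contract_form w P b = 0.
Proof. by move=> P0; rewrite /contract_form big1 ?mulr0 // => I _; rewrite P0 mulr0. Qed.

End ContractForm.

Section LieTheory.
Context {R : realType} {m : nat} {M : manifold R m} {r : nat} {E : vbundle M r}.

Lemma smooth_form_lin (k : nat) f (w z : kform E k) :
  smooth f -> smooth_form w -> smooth_form z ->
  smooth_form (fun x v => f x * w x v + z x v).
Proof.
move=> sf sw sz; apply: smooth_formP => [x|X sX].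
  split=> [v i a u u'|v i j ij vij].
    by rewrite !(sw.1 x).1 !(sz.1 x).1; ring.
  by rewrite ((sw.1 x).2 _ _ _ ij vij) ((sz.1 x).2 _ _ _ ij vij) mulr0 addr0.
apply: smoothD; last exact: smooth_form_eval.
by apply: smoothM => //; exact: smooth_form_eval.
Qed.

Lemma smooth_sectP (X : sect E) :
  (forall b, smooth_dual_sect b -> smooth (fun x => b x (X x))) -> smooth_sect X.
Proof.
move=> sX j a; apply: smooth_on_local => x dx.
have [phi [th [_ sth nth _ _]]] := local_frame (E := dual_bundle E) (j := j) dx.
move: nth; rewrite /prop_near1 nbhsE => -[W [oW Wx] Wth]; exists W => //.
apply: (@smooth_on_eq _ _ _ _ (fun x => (th a x : covector (E x)) (X x))) => // [y Wy|].
  by have [dy ->] := Wth y Wy; rewrite tnth_mktuple lfunE.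
by apply: smooth_onW; apply: sX; apply/smooth_dual_sectE; exact: sth.
Qed.

Lemma lieZ D dl (k : nat) f (w : kform E k) (X : 'I_k -> sect E) x :
  derivation D dl -> smooth f -> smooth_form w -> (forall i, smooth_sect (X i)) ->
  lie D dl (fun y v => f y * w y v) X x =
  D f x * w x (fun i => X i x) + f x * lie D dl w X x.
Proof.
move=> der sf sw sX; rewrite /lie (derM der) //; last exact: smooth_form_eval.
by rewrite -mulr_sumr; ring.
Qed.

(** Applying the first derivation to f2 w gives (D1 f2 + f1 f2) w; in the commutator the products f1
    f2 cancel, and one divides by a nonzero value of w. *)
Lemma commutator_multiplier D D1 D2 (dl d1 d2 : sect E -> sect E)
    (k : nat) (w : kform E k) f f1 f2 (X : 'I_k -> sect E) x :
  derivation D dl -> derivation D1 d1 -> derivation D2 d2 ->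
  (forall f, smooth f -> forall x, D f x = D1 (D2 f) x - D2 (D1 f) x) ->
  (forall Y, smooth_sect Y -> forall x, dl Y x = d1 (d2 Y) x - d2 (d1 Y) x) ->
  smooth_form w -> smooth f1 -> smooth f2 -> (forall i, smooth_sect (X i)) ->
  (forall X, (forall i, smooth_sect (X i)) -> forall x,
     lie D dl w X x = f x * w x (fun i => X i x)) ->
  (forall X, (forall i, smooth_sect (X i)) -> forall x,
     lie D1 d1 w X x = f1 x * w x (fun i => X i x)) ->
  (forall X, (forall i, smooth_sect (X i)) -> forall x,
     lie D2 d2 w X x = f2 x * w x (fun i => X i x)) ->
  w x (fun i => X i x) != 0 -> f x = D1 f2 x - D2 f1 x.
Proof.
move=> der der1 der2 DE dlE sw sf1 sf2 sX Lw L1w L2w wX.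
apply: (mulIf wX); rewrite -Lw //.
rewrite (lie_commutator (w1 := fun y v => f1 y * w y v) (w2 := fun y v => f2 y * w y v)
  x der der1 der2) //; try by [move=> *; rewrite L1w|move=> *; rewrite L2w].
by rewrite !lieZ // L1w // L2w //; ring.
Qed.

End LieTheory.

Section Nambu.
Context {R : realType} {m : nat} {M : manifold R m} {r : nat} {A : lie_algebroid M r}.

Lemma anchor_commutator (X Y : sect A) f : smooth_sect X -> smooth_sect Y -> smooth f ->
  forall x, anchor_act (bracket X Y) f x =
    anchor_act X (anchor_act Y f) x - anchor_act Y (anchor_act X f) x.
Proof. by move=> sX sY sf x; exact: anchor_bracket. Qed.

Lemma bracket_commutator (X Y Z : sect A) :
  smooth_sect X -> smooth_sect Y -> smooth_sect Z -> forall x,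
  bracket (bracket X Y) Z x = bracket X (bracket Y Z) x - bracket Y (bracket X Z) x.
Proof. by move=> sX sY sZ x; rewrite bracket_jacobi // addrK. Qed.

Lemma anchor0 (X : sect A) f x : smooth f -> X x = 0 -> anchor_act X f x = 0.
Proof.
move=> sf X0; rewrite /anchor_act X0.
have := anchor_linear (-1) (0 : A x) 0 sf.
by rewrite scaler0 addr0 mulN1r addNr.
Qed.

Lemma smooth_form_pairing (k : nat) (w : kform A k) (P : multisect A k) :
  smooth_form w -> smooth_multisect P -> smooth (form_pairing w P).
Proof.
move=> sw sP.
exact: (@smooth_contract _ _ _ _ A k 0 w P (fun _ _ => 0) sw sP
  (fun i : 'I_0 => match notF (ltn_ord i) with end)).
Qed.

Context {p : nat} (Pi : multisect A p.+2).
Arguments Pi x _ : clear implicits.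
Hypothesis nPi : nambu Pi.
Implicit Types w z : kform A p.+1.

Let sPi : smooth_multisect Pi := nPi.2.1.

(** Here n = p + 2, so w has positive degree, where [lie_form] is the sum described by
    [lie_formE]. *)
Definition nambu_factor w : M -> R := fun x => (-1) ^+ p.+2 * form_pairing (dA w) Pi x.

Lemma smooth_nambu_factor w : smooth_form w -> smooth (nambu_factor w).
Proof.
move=> sw; apply: smoothM; first exact: smooth_cst.
by apply: smooth_form_pairing => //; exact: (dA_spec sw).1.
Qed.

Lemma sharpE w x (b : covector (A x)) :
  b (sharp Pi w x) = contract_form (l := 1) (w x) (Pi x) (fun=> b).
Proof.
rewrite -(bidual_vectorE (fun=> b)) //.
by apply: contract_form_multilinear; exact: sPi.1.
Qed.

Lemma smooth_sharp w : smooth_form w -> smooth_sect (sharp Pi w).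
Proof.
move=> sw; apply: smooth_sectP => b sb.
apply: (smooth_eq (f := fun x => contract_form (l := 1) (w x) (Pi x) (fun=> b x))).
  by move=> x; rewrite sharpE.
exact: (@smooth_contract _ _ _ _ A p.+1 1 w Pi (fun _ => b) sw sPi (fun _ => sb)).
Qed.

Lemma smooth_leibniz w z : smooth_form w -> smooth_form z ->
  smooth_form (leibniz_bracket Pi w z).
Proof.
move=> sw sz; have sX := smooth_sharp sw.
have := smooth_form_lin (smooth_nambu_factor sw) sz (lie_form_smooth sz sX).
congr smooth_form; apply: functional_extensionality_dep => x; apply/funext => v.
by rewrite addrC.
Qed.

Lemma lie_sharp w b x : smooth_form w -> (forall i, smooth_dual_sect (b i)) ->
  @lie _ _ _ _ (dual_bundle A) (anchor_act (sharp Pi w)) (lie_dual (sharp Pi w)) _ Pi b x =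
  nambu_factor w x * Pi x (fun i => b i x).
Proof.
move=> sw sb; rewrite -(schouten_spec (smooth_sharp sw) sPi).2 //.
by rewrite nPi.2.2.
Qed.

(** Differentiating b (X_z) along X_w gives three terms, in which the derivative falls on z, on [Pi]
    or on b. The first two add up to b of the sharp of [w, z]; the third is X_w (b (X_z)) - b
    ([X_w, X_z]). *)
Lemma sharp_leibniz w z : smooth_form w -> smooth_form z ->
  sharp Pi (leibniz_bracket Pi w z) = bracket (sharp Pi w) (sharp Pi z).
Proof.
move=> sw sz; have [sX sY] := (smooth_sharp sw, smooth_sharp sz).
apply: functional_extensionality_dep => x; apply: sect_ext => b0.
pose b : dual_sect A := @ext _ _ _ _ (dual_bundle A) x b0.
have sb : smooth_dual_sect b by apply/smooth_dual_sectE; exact: smooth_ext.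
have -> : b0 = b x by rewrite /b extE.
have := @der_contract _ _ _ _ A p.+1 1 z Pi (fun _ => b) _ _ _
  (lie_form (sharp Pi w) z) (schouten (sharp Pi w) Pi) x
  (ad_derivation sX) (lie_dual_derivation sX) sz sPi (fun _ => sb).
have [ssch schE] := schouten_spec sX sPi.
move=> /(_ ((lie_form_smooth sz sX).1 x).1 (ssch.1 x)).
move=> /(_ (fun Y sYi => lie_formE x sz sX sYi) (fun c sc => schE c sc x)).
rewrite nPi.2.2 // big_ord1 (contract_formZr (l := 1)).
have -> : dfwith (fun _ : 'I_1 => b x) ord0 (lie_dual (sharp Pi w) b x) = (fun _ => lie_dual (sharp Pi w) b x).
  by apply/funext => i; rewrite (ord1 i) dfwithin.
rewrite -!sharpE.
have -> : (fun y => contract_form (l := 1) (z y) (Pi y) (fun=> b y)) = (fun y => b y (sharp Pi z y)).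
  by apply/funext => y; rewrite sharpE.
rewrite lie_dual_derivation //.
have -> : b x (sharp Pi (leibniz_bracket Pi w z) x) =
    nambu_factor w x * b x (sharp Pi z x) + b x (sharp Pi (lie_form (sharp Pi w) z) x).
  rewrite !sharpE -(contract_formDl (l := 1)); congr contract_form.
  by apply/funext => v; rewrite addrC.
(* Here a is X_w (b (X_z)) and t is b ([X_w, X_z]). *)
have cancel (a u v t : R) : a = u + v + (a - t) -> v + u = t by move=> e; lra.
exact: cancel.
Qed.

Lemma nambu_factor_leibniz w z : smooth_form w -> smooth_form z -> forall x,
  nambu_factor (leibniz_bracket Pi w z) x =
  anchor_act (sharp Pi w) (nambu_factor z) x - anchor_act (sharp Pi z) (nambu_factor w) x.
Proof.
move=> sw sz x; have [sX sY] := (smooth_sharp sw, smooth_sharp sz).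
have [sfw sfz] := (smooth_nambu_factor sw, smooth_nambu_factor sz).
have [[b0 Pib]|Pi0] := pselect (exists b, Pi x b != 0); last first.
  have {}Pi0 b : Pi x b = 0.
    by apply/eqP; apply: contrapT => /negP Pib; apply: Pi0; exists b.
  have sharp0 u : sharp Pi u x = 0.
    by apply: sect_ext => b; rewrite sharpE linear0 contract_form0r.
  rewrite !anchor0 // subrr /nambu_factor /form_pairing /pairing contract_form0r ?mulr0 //.
pose b i : dual_sect A := @ext _ _ _ _ (dual_bundle A) x (b0 i).
have sb i : @smooth_sect _ _ _ _ (dual_bundle A) (b i) by exact: smooth_ext.
have bE : (fun i => b i x) = b0 by apply/funext => i; rewrite /b extE.
have sXY := bracket_smooth sX sY.
have [[aX aY] aXY] := (ad_derivation sX, ad_derivation sY, ad_derivation sXY).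
have [[dX dY] dXY] := (lie_dual_derivation sX, lie_dual_derivation sY, lie_dual_derivation sXY).
have sB := smooth_leibniz sw sz.
apply: (@commutator_multiplier _ _ _ _ (dual_bundle A) _ _ _ _ _ _ _ Pi _ _ _ b x
  (dual_derivationP aXY dXY) (dual_derivationP aX dX) (dual_derivationP aY dY)) => //.
- by move=> f sf y; exact: anchor_commutator.
- move=> c /smooth_dual_sectE sc y.
  apply: (dual_commutator aXY aX aY dXY dX dY) => //.
  + by move=> f sf y'; exact: anchor_commutator.
  + by move=> Z sZ y'; exact: bracket_commutator.
- exact/smooth_multisectE.
(* Since [X_w, X_z] is the sharp of [w, z], its multiplier on [Pi] is the factor of [w, z]. *)
- move=> c sc y; rewrite -sharp_leibniz //; apply: lie_sharp => // i.
  exact/smooth_dual_sectE.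
- by move=> c sc y; apply: lie_sharp => // i; exact/smooth_dual_sectE.
- by move=> c sc y; apply: lie_sharp => // i; exact/smooth_dual_sectE.
- by rewrite bE.
Qed.

End Nambu.

(** * The cocycle identity *)

Lemma modular_cocycle (R : realType) (m r p : nat) (M : manifold R m)
    (A : lie_algebroid M r.+1) (Pi : multisect A p.+2) (mu : kform A r.+1)
    (Mmu : multisect A p.+1) (w z : kform A p.+1) (x : M) :
  nambu Pi -> smooth_form mu -> nowhere_vanishing mu ->
  modular_tensor_field Pi mu Mmu -> smooth_form w -> smooth_form z ->
  form_pairing (leibniz_bracket Pi w z) Mmu x =
  anchor_act (sharp Pi w) (form_pairing z Mmu) x
  - anchor_act (sharp Pi z) (form_pairing w Mmu) x.
Proof.
move=> nPi smu mu0 [sMmu MmuE] sw sz.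
have [sX sY] := (smooth_sharp nPi sw, smooth_sharp nPi sz).
have sB := smooth_leibniz nPi sw sz.
(* This is the divergence of X_u with respect to [mu]. *)
pose g u y := form_pairing u Mmu y - nambu_factor Pi u y.
have sg u : smooth_form u -> smooth (g u).
  move=> su; apply: smoothD; first exact: smooth_form_pairing.
  by apply: smoothN; exact: smooth_nambu_factor.
have lie_mu u (V : 'I_r.+1 -> sect A) y : smooth_form u -> (forall i, smooth_sect (V i)) ->
    lie (anchor_act (sharp Pi u)) (bracket (sharp Pi u)) mu V y = g u y * mu y (fun i => V i y).
  move=> su sV; rewrite -lie_formE //; last exact: smooth_sharp.
  by rewrite mulrBl MmuE // addrK.
have [v muv] := mu0 x.
have sXY := bracket_smooth sX sY.
have gB : g (leibniz_bracket Pi w z) x =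
    anchor_act (sharp Pi w) (g z) x - anchor_act (sharp Pi z) (g w) x.
  apply: (@commutator_multiplier _ _ _ _ _ _ _ _ _ _ _ _ mu _ _ _ (fun i => ext (v i)) x
    (ad_derivation sXY) (ad_derivation sX) (ad_derivation sY)) => //; try exact: sg.
  - by move=> f sf y; exact: anchor_commutator.
  - by move=> Z sZ y; exact: bracket_commutator.
  - by move=> i; exact: smooth_ext.
  - by move=> V sV y; rewrite -sharp_leibniz // lie_mu.
  - by move=> V sV y; rewrite lie_mu.
  - by move=> V sV y; rewrite lie_mu.
  - by rewrite (_ : (fun i => _) = v) //; apply/funext => i; rewrite extE.
have sc u : smooth_form u -> smooth (form_pairing u Mmu).
  by move=> su; exact: smooth_form_pairing.
have sf u : smooth_form u -> smooth (nambu_factor Pi u) by move=> su; exact: smooth_nambu_factor.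
move: gB; rewrite /g nambu_factor_leibniz //.
rewrite (derB (ad_derivation sX) x (sc _ sz) (sf _ sz)).
rewrite (derB (ad_derivation sY) x (sc _ sw) (sf _ sw)).
by move=> e; lra.
Qed.

Theorem proposition4p7 (R : realType) (m r p : nat) (M : manifold R m)
    (A : lie_algebroid M r) (o : orientation A)
    (Pi : multisect A p.+1) (mu : kform A r) (Mmu : multisect A p) :
  nambu Pi ->
  smooth_form mu ->
  nowhere_vanishing mu ->
  modular_tensor_field Pi mu Mmu ->
  one_cocycle Pi (fun w : kform A p => form_pairing w Mmu).
Proof.
move=> nPi smu mu0 Mmod; split.
  split=> [w sw|a w z sw sz]; first exact: smooth_form_pairing Mmod.1.
  by apply/funext => x; exact: (contract_formDl (l := 0)).
have [/andP[p3 pr] _] := nPi.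
move: nPi smu mu0 Mmod p3 pr.
(* The bounds 3 <= p + 1 <= r exclude p = 0 and r = 0, so w, z and [mu] have positive degree. *)
case: p Pi Mmu => [//|p] Pi Mmu; case: r M A o Pi mu Mmu => [//|r] M A o Pi mu Mmu.
move=> nPi smu mu0 Mmod _ _ w z sw sz; apply/funext => x.
by rewrite (modular_cocycle (w := w) (z := z) x nPi smu mu0 Mmod sw sz).
Qed.
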